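(* The output distribution of a depth-$p$ QAOA circuit on $n$ qubits with interaction degree at most $2$ can be sampled exactly by a classical randomized algorithm in time $(np)^{O(1)}\exp(O(p))$. When $p=O(\log n)$, this is $n^{O(1)}$.
   Context: **QAOA circuits.** A cost function $C(x_1,\dots,x_n)$ on $n$ binary variables is given together with a decomposition $C=\sum_i C_i$ into (real-valued) terms each depending on at most two variables. It is viewed as the diagonal operator $C|z\rangle=C(z)|z\rangle$ on $n$ qubits. With $B=\sum_{j=1}^n X_j$ ($X_j$ the Pauli $X$ operator on qubit $j$) and parameters $\gamma_1,\dots,\gamma_p,\beta_1,\dots,\beta_p\in\mathbf{R}$, the depth-$p$ QAOA circuit prepares $$e^{-i\beta_pB}e^{-i\gamma_pC}\cdots e^{-i\beta_1B}e^{-i\gamma_1C}|+\rangle^{\otimes n},$$ and the state is then measured in the computational basis; the output distribution is the resulting distribution on $\{0,1\}^n$. Each phase layer $e^{-i\gamma_kC}$ factors into commuting one- and two-qubit diagonal gates (the terms on a given pair of qubits merge into a single two-qubit gate), and each mixing layer $e^{-i\beta_kB}$ into single-qubit rotations. **Interaction degree.** The interaction graph of the decomposition $C=\sum_iC_i$ is the simple graph on $\{1,\dots,n\}$ with an edge $\{j,k\}$ whenever some term $C_i$ depends nontrivially on both variables $j$ and $k$, meaning that flipping either bit can change the value of $C_i$. The interaction degree is the maximum vertex degree of this graph. **Cost model.** Time bounds count arithmetic operations on matrix entries; for arbitrary real parameters they are understood in the real-arithmetic model. *)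

(* Defs.v *)
From HB Require Import structures.
From mathcomp Require Import all_boot all_order all_algebra.
From mathcomp Require Import all_classical all_reals all_analysis.
From mathcomp.real_closed Require Import complex.

Set Implicit Arguments.
Unset Strict Implicit.
Unset Printing Implicit Defensive.

Import Order.TTheory GRing.Theory Num.Theory.
Import numFieldNormedType.Exports.
Local Open Scope ring_scope.
Local Open Scope complex_scope.

Definition bits (n : nat) := {ffun 'I_n -> bool}.

Definition flip (n : nat) (j : 'I_n) (x : bits n) : bits n :=
  [ffun k => if k == j then ~~ x k else x k].

Definition support (R : realType) (n : nat) (f : bits n -> R) : {set 'I_n} :=
  [set j | [exists x, f (flip j x) != f x]].

Record qaoa (R : realType) (n p : nat) := Qaoa {
  nterms : nat;
  term : 'I_nterms -> bits n -> R;
  term_local : forall i, (#|support (term i)| <= 2)%N;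
  gamma : 'I_p -> R;
  beta : 'I_p -> R }.

Definition cost (R : realType) (n p : nat) (Q : qaoa R n p) (z : bits n) : R :=
  \sum_i term (q := Q) i z.

Definition interacts (R : realType) (n p : nat) (Q : qaoa R n p) : rel 'I_n :=
  fun j l => (j != l) &&
    [exists i, (j \in support (term (q := Q) i)) &&
               (l \in support (term (q := Q) i))].

Definition interaction_degree (R : realType) (n p : nat) (Q : qaoa R n p) : nat :=
  \max_(j < n) #|[set l | interacts Q j l]|.

(* Operators on n qubits are matrices whose rows and columns are the bit
   strings, numbered by enum_rank / enum_val. *)
Notation dim n := #|{: bits n}|.

Definition cost_op (R : realType) (n p : nat) (Q : qaoa R n p) : 'M[R[i]]_(dim n) :=
  diag_mx (\row_x (cost Q (enum_val x))%:C).

Definition pauliX (R : realType) (n : nat) (j : 'I_n) : 'M[R[i]]_(dim n) :=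
  \matrix_(x, y) (enum_val x == flip j (enum_val y))%:R.

Definition mixer (R : realType) (n : nat) : 'M[R[i]]_(dim n) :=
  \sum_(j < n) pauliX R j.

(* R[i] only carries its norm topology through the alias R[i]^o. *)
Definition expmx (R : realType) (N : nat) (A : 'M[R[i]]_N) : 'M[R[i]]_N :=
  \matrix_(x, y) limn (series (fun k : nat => (k`!%:R)^-1 * (A ^+ k) x y : R[i]^o)).

Definition plus_state (R : realType) (n : nat) : 'cV[R[i]]_(dim n) :=
  const_mx (((Num.sqrt 2)^-1 ^+ n)%:C).

Definition layer (R : realType) (n p : nat) (Q : qaoa R n p) (k : 'I_p) :
    'M[R[i]]_(dim n) :=
  expmx ((0 -i* beta Q k) *: mixer R n) *m
  expmx ((0 -i* gamma Q k) *: cost_op Q).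

Definition qaoa_state (R : realType) (n p : nat) (Q : qaoa R n p) :
    'cV[R[i]]_(dim n) :=
  foldl (fun psi k => layer Q k *m psi) (plus_state R n) (enum 'I_p).

Definition output_distribution (R : realType) (n p : nat) (Q : qaoa R n p)
    (z : bits n) : R :=
  (ComplexField.Normc.normc (qaoa_state Q (enum_rank z) ord0)) ^+ 2.

(* A randomized RAM with exact real arithmetic.  Memory consists of arrays of
   natural numbers (for indexing and control) and arrays of real numbers, both
   named by natural numbers; a scalar variable is a cell of an array.  Each command costs one unit of time.  A program contains
   finitely many expressions of bounded size, hence each unit performs O(1)
   operations.  Unit-cost multiplication and rounding are deliberately absent
   on the natural-number side, and reals cannot be converted to integers. *)
Inductive nexpr : Type :=
| NConst of nat
| NGet of nat & nexpr
| NAdd of nexpr & nexpr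
| NSub of nexpr & nexpr.

Inductive rexpr : Type :=
| RZero
| ROne
| RGet of nat & nexpr
| RAdd of rexpr & rexpr
| RSub of rexpr & rexpr
| RMul of rexpr & rexpr
| RDiv of rexpr & rexpr.

Inductive test : Type :=
| NLe of nexpr & nexpr
| RLe of rexpr & rexpr.

Inductive cmd : Type :=
| Skip
| NSet of nat & nexpr & nexpr
| RSet of nat & nexpr & rexpr
| Coin of nat & nexpr & rexpr
| Seq of cmd & cmd
| If of test & cmd & cmd
| While of test & cmd.

Record store (R : realType) := Store {
  nmem : nat -> nat -> nat;
  rmem : nat -> nat -> R }.

Definition update (V : Type) (m : nat -> nat -> V) (a e : nat) (v : V) :
    nat -> nat -> V :=
  fun a' e' => if (a' == a) && (e' == e) then v else m a' e'.

Section Semantics.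
Variable R : realType.

Fixpoint neval (s : store R) (e : nexpr) : nat :=
  match e with
  | NConst k => k
  | NGet a e => nmem s a (neval s e)
  | NAdd e1 e2 => (neval s e1 + neval s e2)%N
  | NSub e1 e2 => (neval s e1 - neval s e2)%N
  end.

Fixpoint reval (s : store R) (r : rexpr) : R :=
  match r with
  | RZero => 0
  | ROne => 1
  | RGet a e => rmem s a (neval s e)
  | RAdd r1 r2 => reval s r1 + reval s r2
  | RSub r1 r2 => reval s r1 - reval s r2
  | RMul r1 r2 => reval s r1 * reval s r2
  | RDiv r1 r2 => reval s r1 / reval s r2
  end.

Definition teval (s : store R) (b : test) : bool :=
  match b with
  | NLe e1 e2 => (neval s e1 <= neval s e2)%N
  | RLe r1 r2 => reval s r1 <= reval s r2
  end.

Definition nset (s : store R) (a e v : nat) : store R :=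
  Store (update (nmem s) a e v) (rmem s).

Definition rset (s : store R) (a e : nat) (v : R) : store R :=
  Store (nmem s) (update (rmem s) a e v).

(* A configuration is the list of commands still to be executed together with
   the store; the machine has halted when the list is empty. *)
Definition config := (seq cmd * store R)%type.

Definition halted (c : config) : bool := nilp c.1.

(* The possible successors of a configuration, with their probabilities.  Coin
   amounts to drawing a fresh uniform u in [0, 1] and testing u < r, whence the
   clamping of r to [0, 1]. *)
Definition step (c : config) : seq (R * config) :=
  let: (todo, s) := c in
  match todo with
  | [::] => [:: (1, c)]
  | Skip :: k => [:: (1, (k, s))]
  | NSet a e e' :: k => [:: (1, (k, nset s a (neval s e) (neval s e')))]
  | RSet a e r :: k => [:: (1, (k, rset s a (neval s e) (reval s r)))]
  | Coin a e r :: k =>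
      let q := Num.max 0 (Num.min 1 (reval s r)) in
      [:: (q, (k, nset s a (neval s e) 1%N));
          (1 - q, (k, nset s a (neval s e) 0%N))]
  | Seq c1 c2 :: k => [:: (1, (c1 :: c2 :: k, s))]
  | If b c1 c2 :: k => [:: (1, ((if teval s b then c1 else c2) :: k, s))]
  | While b c1 :: k =>
      [:: (1, (if teval s b then c1 :: todo else k, s))]
  end.

Fixpoint run (t : nat) (c : config) : seq (R * config) :=
  if t is t'.+1 then
    flatten [seq [seq (o.1 * o'.1, o'.2) | o' <- run t' o.2] | o <- step c]
  else [:: (1, c)].

Definition outputs (n : nat) (z : bits n) (s : store R) : bool :=
  [forall j : 'I_n, nmem s 2 j == z j :> nat].

(* Started on s, the program halts within t steps whatever the outcomes of the
   coins, and its output is then distributed exactly according to D. *)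
Definition samples_within (prog : cmd) (s : store R) (n : nat)
    (D : bits n -> R) (t : nat) : Prop :=
  all (fun o => (o.1 != 0) ==> halted o.2) (run t ([:: prog], s)) /\
  (forall z : bits n,
     \sum_(o <- run t ([:: prog], s) | outputs z o.2.2) o.1 = D z).

End Semantics.

(* The array with v i in cell addr i (addr is injective) and x0 elsewhere. *)
Definition table (I : finType) (V : Type) (x0 : V) (addr : I -> nat)
    (v : I -> V) : nat -> V :=
  fun e => if [pick i | addr i == e] is Some i then v i else x0.

(* The merged one- and two-qubit terms: for j != l, the sum of all terms on the
   pair {j, l}, evaluated at x_j = a, x_l = b; for j = l, the sum of all terms
   on the single qubit j, evaluated at x_j = a.  The terms that are constant
   only contribute a global phase and are dropped. *)
Definition merged_cost (R : realType) (n p : nat) (Q : qaoa R n p)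
    (j l : 'I_n) (a b : bool) : R :=
  \sum_(i | support (term (q := Q) i) == [set j; l])
    term (q := Q) i [ffun k => if k == j then a else (k == l) && b].

Definition merged_angle (R : realType) (n p : nat) (Q : qaoa R n p)
    (t : 'I_p * 'I_n * 'I_n * bool * bool) : R :=
  let: (k, j, l, a, b) := t in gamma Q k * merged_cost Q j l a b.

Definition gate_addr (n p : nat) (t : 'I_p * 'I_n * 'I_n * bool * bool) : nat :=
  let: (k, j, l, a, b) := t in (((k * n + j) * n + l) * 4 + (a * 2 + b))%N.

(* Natural-number arrays: 0 holds n and p, 1 the adjacency matrix of the
   interaction graph; array 2 receives the output.  Real arrays: 0 and 1 hold
   cos (beta_k) and - sin (beta_k), which determine the matrix entries of
   exp (- i beta_k X) (real part on the diagonal, imaginary part off it); 2 and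
   3 hold the real and imaginary parts of the diagonal entries of the merged
   gates of the phase layers.  All other cells are 0. *)
Definition input_store (R : realType) (n p : nat) (Q : qaoa R n p) : store R :=
  Store
    (fun arr => match arr with
     | 0 => nth 0%N [:: n; p]
     | 1 => table 0%N (fun t : 'I_n * 'I_n => t.1 * n + t.2)%N
                      (fun t => interacts Q t.1 t.2 : nat)
     | _ => fun _ => 0%N
     end)
    (fun arr => match arr with
     | 0 => table 0 (@nat_of_ord p) (fun k => cos (beta Q k))
     | 1 => table 0 (@nat_of_ord p) (fun k => - sin (beta Q k))
     | 2 => table 0 (@gate_addr n p) (fun t => cos (merged_angle Q t))
     | 3 => table 0 (@gate_addr n p) (fun t => - sin (merged_angle Q t))
     | _ => fun _ => 0
     end).

(* Main.v *)
(* Gate-by-gate sampling (Bravyi, Gosset, Liu).  Keep a bit string z distributed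
   according to the output of the gates applied so far.  A diagonal gate does
   not change this distribution, and a one-qubit gate on qubit J does not change
   the marginal of the other bits; so after a mixing gate on J it suffices to
   redraw z_J from its conditional distribution, that is from the two squared
   amplitudes of z with z_J := 1 and z_J := 0 in the circuit truncated after this
   gate.

   Such an amplitude is a sum over the paths of computational basis states.
   Grouping a path by qubits gives one variable with 2 ^ (K + 1) values per qubit
   and one factor per qubit and per edge of the interaction graph.  The sum is
   computed by eliminating one variable after the other: since the degrees are
   at most 2, eliminating a qubit merely joins its two neighbours by an edge, the
   degrees stay at most 2, and each step costs exp(O(p)). *)

Require Import Defs.
From mathcomp Require Import all_boot all_order all_algebra.
From mathcomp Require Import all_classical all_reals all_analysis.
From mathcomp Require Import complex.
From mathcomp Require Import zify ring lra.
Import Order.TTheory GRing.Theory Num.Theory.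
Import numFieldNormedType.Exports.
Set Implicit Arguments.
Unset Strict Implicit.
Unset Printing Implicit Defensive.
Local Open Scope classical_set_scope.
Local Open Scope ring_scope.

(** * Programs *)

(** One fixed program must serve all [n] and [p], on a machine that neither multiplies nor halves
    naturals in unit time. Addresses are therefore written in radix [B = n + 1 + 2 ^ p], and
    multiples, halves and parities are read from tables of size about [B ^ 3], built by additions.
    [B] is also the unit of all time bounds: an amplitude costs [O(B ^ 5)], each of the [n * p]
    mixing gates needs two of them, whence [B ^ 7], and [B <= 3 * (n * 2 ^ p)]. Coins occur only in
    the outer loops. All the rest is deterministic and handled by a Hoare logic with time bounds,
    while the coins are handled by kernels acting on distributions of bit strings. Since the degrees
    stay at most 2, any elimination order would do; going from qubit [n - 1] down keeps the
    remaining graph on an initial segment of the naturals. Missing neighbours are replaced by a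
    dummy vertex [n], so that one update rule covers all cases. If both candidates for the redrawn
    bit have amplitude 0, the machine computes [0 / 0]; this is harmless because such a string has
    marginal probability 0. *)

Definition setb n (z : bits n) (j : 'I_n) (b : bool) : bits n :=
  [ffun k => if k == j then b else z k].

Lemma setbb n (z : bits n) j b b' : setb (setb z j b) j b' = setb z j b'.
Proof. by apply/ffunP=> k; rewrite !ffunE; case: eqP. Qed.

Lemma setb_id n (z : bits n) j b : z j = b -> setb z j b = z.
Proof. by move=> <-; apply/ffunP=> k; rewrite ffunE; case: eqP => [->|]. Qed.

Lemma flip_setb n (z : bits n) j : flip j z = setb z j (~~ z j).
Proof. by apply/ffunP=> k; rewrite !ffunE; case: eqP => [->|]. Qed.

Lemma flipK n (j : 'I_n) : involutive (flip j).
Proof.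
by move=> z; apply/ffunP=> k; rewrite !ffunE; case: eqP => // ->; rewrite negbK.
Qed.

(** Adding to a sum its image under the involution [flip j] groups the strings that differ only at
    [j]. Comparing doubled sums avoids choosing a representative of each pair. *)
Lemma eq_sum_flip (R : numFieldType) n (j : 'I_n) (F G : bits n -> R) :
  (forall z, F (setb z j true) + F (setb z j false) =
             G (setb z j true) + G (setb z j false)) ->
  \sum_z F z = \sum_z G z.
Proof.
move=> FG.
have dbl (H : bits n -> R) :
    (\sum_z H z) *+ 2 = \sum_z (H (setb z j true) + H (setb z j false)).
  rewrite mulr2n [X in _ + X](reindex_inj (can_inj (flipK j))) -big_split /=.
  apply: eq_bigr => z _; rewrite flip_setb.
  case zj: (z j); rewrite -[in H z](setb_id zj) //= addrC.
  by [].
have := dbl F; rewrite (eq_bigr _ (fun z _ => FG z)) -dbl => /eqP.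
by rewrite eqrMn2r => /eqP.
Qed.

Section Machine.
Variable R : realType.
Implicit Types (s : store R) (c : cmd).

(** Halted configurations stay put, so the condition can be asked for all [t] from [T] on. This
    makes it monotone in [T], and steps and branches compose with mere upper bounds on time. *)
Definition outcome (cfg : config R) (T n : nat) (g : bits n -> R) : Prop :=
  forall t, (T <= t)%N ->
    all (fun o => (o.1 != 0) ==> halted o.2) (run t cfg) /\
    forall z, \sum_(o <- run t cfg | outputs z o.2.2) o.1 = g z.

Lemma run_halted t s : run t ([::], s) = [:: (1, ([::], s))].
Proof. by elim: t => //= t ->; rewrite /= mulr1. Qed.

Lemma outcome_halted n s :
  outcome ([::], s) 0 (fun z : bits n => (outputs z s)%:R).
Proof.
move=> t _; rewrite run_halted; split=> [|z]; first by rewrite /= implybT.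
by rewrite big_cons big_nil /=; case: ifP => _; rewrite ?addr0.
Qed.

Lemma outcome_step n cfg cfg' T (g : bits n -> R) :
  step cfg = [:: (1, cfg')] -> outcome cfg' T g -> outcome cfg T.+1 g.
Proof.
move=> E H [//|t] /H.
have -> // : run t.+1 cfg = run t cfg'.
rewrite /= E /= cats0 -[RHS]map_id; apply: eq_map => -[w o] /=.
by rewrite mul1r.
Qed.

Lemma outcome_branch n cfg q1 q2 cfg1 cfg2 T (g g1 g2 : bits n -> R) :
  step cfg = [:: (q1, cfg1); (q2, cfg2)] ->
  outcome cfg1 T g1 -> outcome cfg2 T g2 ->
  (forall z, g z = q1 * g1 z + q2 * g2 z) -> outcome cfg T.+1 g.
Proof.
move=> E H1 H2 Eg [//|t] le_t.
have [h1 s1] := H1 t le_t; have [h2 s2] := H2 t le_t.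
rewrite /= E /= cats0; split=> [|z].
  rewrite all_cat !all_map; apply/andP; split.
    apply: sub_all h1 => o /= /implyP h; apply/implyP => w0; apply: h.
    by apply: contraNneq w0 => ->; rewrite mulr0.
  apply: sub_all h2 => o /= /implyP h; apply/implyP => w0; apply: h.
  by apply: contraNneq w0 => ->; rewrite mulr0.
by rewrite big_cat !big_map /= -!big_distrr /= s1 s2 Eg.
Qed.

Lemma outcome_mono n cfg T T' (g : bits n -> R) :
  (T <= T')%N -> outcome cfg T g -> outcome cfg T' g.
Proof. by move=> le_T H t le_t; apply: H; apply: leq_trans le_t. Qed.

(** Big-step semantics of coin-free runs with exact step counts. [Coin] has no rule on purpose: a
    derivation certifies a deterministic run. *)
Inductive exec : cmd -> store R -> nat -> store R -> Prop :=
| ExecSkip s : exec Skip s 1 s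
| ExecNSet a e e' s : exec (NSet a e e') s 1 (nset s a (neval s e) (neval s e'))
| ExecRSet a e r s : exec (RSet a e r) s 1 (rset s a (neval s e) (reval s r))
| ExecSeq c1 c2 s t1 s1 t2 s2 :
    exec c1 s t1 s1 -> exec c2 s1 t2 s2 -> exec (Seq c1 c2) s (t1 + t2).+1 s2
| ExecIf b c1 c2 s t s' :
    exec (if teval s b then c1 else c2) s t s' -> exec (If b c1 c2) s t.+1 s'
| ExecStop b c s : ~~ teval s b -> exec (While b c) s 1 s
| ExecLoop b c s t1 s1 t2 s2 :
    teval s b -> exec c s t1 s1 -> exec (While b c) s1 t2 s2 ->
    exec (While b c) s (t1 + t2).+1 s2.

Lemma outcome_exec n c s t s' k T (g : bits n -> R) :
  exec c s t s' -> outcome (k, s') T g -> outcome (c :: k, s) (t + T)%N g.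
Proof.
move=> H; elim: H k T => {c s t s'} //=.
- by move=> s k T H; rewrite add1n; apply: outcome_step H.
- by move=> a e e' s k T H; rewrite add1n; apply: outcome_step H.
- by move=> a e r s k T H; rewrite add1n; apply: outcome_step H.
- move=> c1 c2 s t1 s1 t2 s2 _ IH1 _ IH2 k T H.
  rewrite addSn -addnA; apply: outcome_step; first by [].
  by apply: IH1; apply: IH2.
- move=> b c1 c2 s t s' _ IH k T H.
  rewrite addSn; apply: outcome_step; first by [].
  exact: IH.
- move=> b c s /negbTE nb k T H; rewrite add1n; apply: outcome_step H.
  by rewrite /= nb.
- move=> b c s t1 s1 t2 s2 hb _ IH1 _ IH2 k T H.
  rewrite addSn -addnA; apply: (@outcome_step _ _ (c :: While b c :: k, s)).
    by rewrite /= hb.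
  by apply: IH1; apply: IH2.
Qed.

Fixpoint nwrites c : seq nat :=
  match c with
  | NSet a _ _ | Coin a _ _ => [:: a]
  | Seq c1 c2 | If _ c1 c2 => nwrites c1 ++ nwrites c2
  | While _ c1 => nwrites c1
  | _ => [::]
  end.

Fixpoint rwrites c : seq nat :=
  match c with
  | RSet a _ _ => [:: a]
  | Seq c1 c2 | If _ c1 c2 => rwrites c1 ++ rwrites c2
  | While _ c1 => rwrites c1
  | _ => [::]
  end.

(** Frames are tracked per array, not per cell. As each scalar has an array of its own, frame
    conditions become membership tests in concrete lists, decided by computation. *)
Definition framed (L L' : seq nat) s s' : Prop :=
  (forall a e, a \notin L -> nmem s' a e = nmem s a e) /\
  (forall a e, a \notin L' -> rmem s' a e = rmem s a e).

Lemma framed_refl L L' s : framed L L' s s.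
Proof. by []. Qed.

Lemma framed_trans L L' s1 s2 s3 :
  framed L L' s1 s2 -> framed L L' s2 s3 -> framed L L' s1 s3.
Proof.
by move=> [n1 r1] [n2 r2]; split=> a e h; [rewrite n2 // n1|rewrite r2 // r1].
Qed.

Lemma framed_sub L1 L1' L2 L2' s s' :
  {subset L1 <= L2} -> {subset L1' <= L2'} ->
  framed L1 L1' s s' -> framed L2 L2' s s'.
Proof.
move=> sL sL' [hn hr]; split=> a e aL; [apply: hn|apply: hr].
  by apply: contra aL; apply: sL.
by apply: contra aL; apply: sL'.
Qed.

Lemma framed_exec c s t s' :
  exec c s t s' -> framed (nwrites c) (rwrites c) s s'.
Proof.
elim=> {c s t s'} //=.
- move=> a e e' s; split=> // a' e0 /=; rewrite inE => /negbTE ne.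
  by rewrite /update ne.
- move=> a e r s; split=> // a' e0 /=; rewrite inE => /negbTE ne.
  by rewrite /update ne.
- move=> c1 c2 s t1 s1 t2 s2 _ IH1 _ IH2; apply: (@framed_trans _ _ _ s1).
    by apply: framed_sub IH1 => x xL; rewrite mem_cat xL.
  by apply: framed_sub IH2 => x xL; rewrite mem_cat xL orbT.
- move=> b c1 c2 s t s' _; case: (teval s b); apply: framed_sub => x xL;
    by rewrite mem_cat xL ?orbT.
- by move=> b c s t1 s1 t2 s2 _ _ IH1 _; apply: framed_trans.
Qed.

Definition tc c s (T : nat) (Q : store R -> Prop) : Prop :=
  exists s' t, [/\ exec c s t s', (t <= T)%N & Q s'].

Lemma tc_conseq c s T T' (Q Q' : store R -> Prop) :
  tc c s T Q -> (T <= T')%N ->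
  (forall s', framed (nwrites c) (rwrites c) s s' -> Q s' -> Q' s') ->
  tc c s T' Q'.
Proof.
move=> [s' [t [e le_t q]]] le_T QQ'; exists s', t; split=> //.
  exact: leq_trans le_T.
by apply: QQ' => //; apply: framed_exec e.
Qed.

Lemma tc_skip s T (Q : store R -> Prop) : (0 < T)%N -> Q s -> tc Skip s T Q.
Proof. by move=> T0 q; exists s, 1%N; split=> //; constructor. Qed.

Lemma tc_nset a e e' s T (Q : store R -> Prop) : (0 < T)%N ->
  Q (nset s a (neval s e) (neval s e')) -> tc (NSet a e e') s T Q.
Proof. by move=> T0 q; eexists _, 1%N; split=> //; [constructor|]. Qed.

Lemma tc_rset a e r s T (Q : store R -> Prop) : (0 < T)%N ->
  Q (rset s a (neval s e) (reval s r)) -> tc (RSet a e r) s T Q.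
Proof. by move=> T0 q; eexists _, 1%N; split=> //; [constructor|]. Qed.

Lemma tc_seq c1 c2 s T1 T2 T (Q : store R -> Prop) : (T1 + T2 < T)%N ->
  tc c1 s T1 (fun s' => tc c2 s' T2 Q) -> tc (Seq c1 c2) s T Q.
Proof.
move=> le_T [s1 [t1 [e1 le1 [s2 [t2 [e2 le2 q]]]]]].
exists s2, (t1 + t2).+1; split=> //; first exact: ExecSeq e1 e2.
by apply: leq_trans le_T; rewrite ltnS leq_add.
Qed.

Lemma tc_if b c1 c2 s T T' (Q : store R -> Prop) : (T < T')%N ->
  (teval s b -> tc c1 s T Q) -> (~~ teval s b -> tc c2 s T Q) ->
  tc (If b c1 c2) s T' Q.
Proof.
move=> le_T h1 h2.
have [s' [t [e le q]]] : tc (if teval s b then c1 else c2) s T Q.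
  by case: ifPn.
by exists s', t.+1; split=> //; [constructor|apply: leq_ltn_trans le_T].
Qed.

Definition nvar (x : nat) : nexpr := NGet x (NConst 0).

Definition For (x : nat) (bound : nexpr) c : cmd :=
  Seq (NSet x (NConst 0) (NConst 0))
      (While (NLe (NAdd (nvar x) (NConst 1)) bound)
             (Seq c (NSet x (NConst 0) (NAdd (nvar x) (NConst 1))))).

(** A round costs [T + 3]: body, test, sequencing and increment. The final [3] pays for sequencing,
    initialisation and the failing test. The bound is re-evaluated in every round, hence the
    hypothesis that it is stable under the frame of the loop. *)
Lemma tc_for x bound c N T T' (I : nat -> store R -> Prop) s :
  x \notin nwrites c ->
  (forall s', framed (x :: nwrites c) (rwrites c) s s' -> neval s' bound = N) ->
  (forall i s' v, I i s' -> I i (nset s' x 0 v)) ->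
  I 0 s ->
  (forall i s', (i < N)%N -> framed (x :: nwrites c) (rwrites c) s s' ->
     nmem s' x 0 = i -> I i s' -> tc c s' T (I i.+1)) ->
  (N * (T + 3) + 3 <= T')%N ->
  tc (For x bound c) s T'
     (fun s' => framed (x :: nwrites c) (rwrites c) s s' /\ I N s').
Proof.
move=> xc hb hI I0 hc le_T.
set fr := framed (x :: nwrites c) (rwrites c) s.
have fr_nset s' v : fr s' -> fr (nset s' x 0 v).
  move=> [hn hr]; split=> // a e; rewrite inE negb_or => /andP[/negbTE ax ac].
  by rewrite /= /update ax /= hn // inE ax.
(* [m] counts the rounds still to come, so the induction starts from the exit of the loop. *)
have loop m s' : (m <= N)%N -> fr s' -> I (N - m)%N s' ->
    nmem s' x 0 = (N - m)%N ->
  tc (While (NLe (NAdd (nvar x) (NConst 1)) bound)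
       (Seq c (NSet x (NConst 0) (NAdd (nvar x) (NConst 1))))) s'
    (m * (T + 3) + 1) (fun s' => fr s' /\ I N s').
  elim: m s' => [|m IH] s' le_m fr_s' I_s' xs'.
    exists s', 1%N; split=> //; last by rewrite subn0 in I_s'.
    by apply: ExecStop; rewrite /= (hb _ fr_s') xs'; lia.
  have [|s1 [t1 [e1 le1 I1]]] := hc (N - m.+1)%N s' _ fr_s' xs' I_s'; first lia.
  have fr1 : fr s1.
    apply: framed_trans fr_s' _; apply: framed_sub (framed_exec e1) => //.
    by move=> a; rewrite inE => ->; rewrite orbT.
  have x1 : nmem s1 x 0 = (N - m.+1)%N.
    by rewrite (framed_exec e1).1.
  have [||||s2 [t2 [e2 le2 I2]]] := IH (nset s1 x 0 (nmem s1 x 0 + 1)%N).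
  - lia.
  - exact: fr_nset.
  - have -> : (N - m = (N - m.+1).+1)%N by lia.
    exact: hI.
  - by rewrite /= /update !eqxx /= x1; lia.
  exists s2, ((t1 + 1).+1 + t2).+1; split=> //.
    apply: ExecLoop e2; first by rewrite /= (hb _ fr_s') xs'; lia.
    by apply: ExecSeq e1 _; constructor.
  by rewrite mulSn; lia.
have [|||s2 [t2 [e2 le2 I2]]] := loop N (nset s x 0 0) (leqnn N).
- exact: fr_nset.
- by rewrite subnn; apply: hI.
- by rewrite subnn /= /update !eqxx.
exists s2, (1 + t2).+1; split=> //; last by lia.
by apply: ExecSeq e2; constructor.
Qed.

(* kappa is the Markov kernel of c acting backwards: it turns the output
   distributions h z' of the runs that continue with bits z' after c into those
   of the runs that start c with bits z. *)
Definition transforms n c (T : nat) (I I' : bits n -> store R -> Prop)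
    (D D' : bits n -> R) : Prop :=
  exists kappa : (bits n -> bits n -> R) -> bits n -> bits n -> R,
    (forall z s, I z s -> forall k T' h,
       (forall z' s', I' z' s' -> outcome (k, s') T' (h z')) ->
       outcome (c :: k, s) (T + T')%N (kappa h z)) /\
    (forall h w, \sum_z D z * kappa h z w = \sum_z D' z * h z w).

Lemma transforms_tc n c T (I I' : bits n -> store R -> Prop) D :
  (forall z s, I z s -> tc c s T (I' z)) -> transforms c T I I' D D.
Proof.
move=> H; exists id; split=> // z s /H[s' [t [e le_t I's']]] k T' h Hk.
apply: (@outcome_mono _ _ (t + T')); first by rewrite leq_add2r.
by apply: outcome_exec e _; apply: Hk.
Qed.

Lemma transforms_seq n c1 c2 T1 T2 (I1 I2 I3 : bits n -> store R -> Prop)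
    D1 D2 D3 :
  transforms c1 T1 I1 I2 D1 D2 -> transforms c2 T2 I2 I3 D2 D3 ->
  transforms (Seq c1 c2) (T1 + T2).+1 I1 I3 D1 D3.
Proof.
move=> [k1 [h1 e1]] [k2 [h2 e2]].
exists (fun h => k1 (k2 h)); split=> [z s Iz k T' h Hk|h w].
  rewrite addSn -addnA; apply: outcome_step; first by [].
  by apply: h1 Iz _ _ _ _ => z' s' Iz'; apply: h2 Iz' _ _ _ Hk.
by rewrite e1 e2.
Qed.

Lemma transforms_weaken n c T T' (I I' J J' : bits n -> store R -> Prop) D D' :
  transforms c T I I' D D' -> (T <= T')%N ->
  (forall z s, J z s -> I z s) -> (forall z s, I' z s -> J' z s) ->
  transforms c T' J J' D D'.
Proof.
move=> [kap [h e]] le_T JI IJ; exists kap; split=> // z s /JI Iz k T0 h0 Hk.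
apply: (@outcome_mono _ _ (T + T0)); first by rewrite leq_add2r.
by apply: h Iz _ _ _ _ => z' s' /IJ; apply: Hk.
Qed.

(** Only the marginal of the other bits, a sum of two values of [D], enters [D']: the old bit [j] is
    forgotten. Hence [q] must not depend on it, and the invariant [I] may have lost track of it, as
    happens once the program has overwritten it to try both values. *)
Lemma transforms_coin n a e r (j : 'I_n) (q : bits n -> R)
    (I I' : bits n -> store R -> Prop) D D' :
  (forall z s, I z s ->
     [/\ neval s e = j, Num.max 0 (Num.min 1 (reval s r)) = q z,
         I' (setb z j true) (nset s a j 1) &
         I' (setb z j false) (nset s a j 0)]) ->
  (forall z b, q (setb z j b) = q z) ->
  (forall z, D' (setb z j true) =
     q z * (D (setb z j true) + D (setb z j false))) ->
  (forall z, D' (setb z j false) =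
     (1 - q z) * (D (setb z j true) + D (setb z j false))) ->
  transforms (Coin a e r) 1 I I' D D'.
Proof.
move=> hI hq D1 D0.
exists (fun h z w => q z * h (setb z j true) w + (1 - q z) * h (setb z j false) w).
split=> [z s /hI[ej eq I1 I0] k T' h Hk|h w].
  rewrite add1n; apply: (outcome_branch _ (Hk _ _ I1) (Hk _ _ I0)) => // /=.
  by rewrite ej eq.
apply: (eq_sum_flip (j := j)) => z; rewrite !hq !setbb D1 D0; ring.
Qed.

Lemma transforms_for n x bound c N T (I : nat -> bits n -> store R -> Prop)
    (D : nat -> bits n -> R) :
  (forall i z s v, I i z s -> I i z (nset s x 0 v)) ->
  (forall i z s, I i z s -> neval s bound = N) ->
  (forall i, (i < N)%N ->
     transforms c T (fun z s => I i z s /\ nmem s x 0 = i)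
       (fun z s => I i.+1 z s /\ nmem s x 0 = i) (D i) (D i.+1)) ->
  transforms (For x bound c) (N * (T + 3) + 3) (I 0) (I N) (D 0) (D N).
Proof.
move=> hI hb hc.
rewrite /For; set W := While _ _.
have loop m : (m <= N)%N -> transforms W (m * (T + 3) + 1)
    (fun z s => I (N - m)%N z s /\ nmem s x 0 = (N - m)%N) (I N) (D (N - m)%N)
    (D N).
  elim: m => [|m IH] le_m.
    rewrite subn0; apply: transforms_tc => z s [Iz xs].
    exists s, 1%N; split=> //.
    by apply: ExecStop; rewrite /= (hb _ _ _ Iz) xs; lia.
  have [kap [h e]] := IH (ltnW le_m).
  have [|kap1 [h1 e1]] := hc (N - m.+1)%N; first lia.
  have eqm : (N - m = (N - m.+1).+1)%N by lia.
  exists (fun h => kap1 (kap h)); split=> [z s [Iz xs] k T' h0 Hk|h0 w].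
    have -> : (m.+1 * (T + 3) + 1 + T' =
               (T + (m * (T + 3) + 1 + T').+1).+2)%N by rewrite mulSn; lia.
    apply: outcome_step; first by rewrite /= (hb _ _ _ Iz) xs ifT //; lia.
    apply: outcome_step; first by [].
    apply: (h1 z s) => // z' s' [Iz' xs'].
    apply: outcome_step; first by [].
    apply: (h z') => //; rewrite /= eqm.
    split; first exact: hI.
    by rewrite /update !eqxx /= xs' addn1.
  by rewrite e1 -eqm e.
have := loop N (leqnn N); rewrite subnn => -[kap [h e]].
exists kap; split=> // z s Iz k T' h0 Hk.
have -> : (N * (T + 3) + 3 + T' = (N * (T + 3) + 1 + T').+2)%N by lia.
apply: outcome_step; first by [].
apply: outcome_step; first by [].
by apply: (h z) => //; split; [apply: hI|rewrite /= /update !eqxx].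
Qed.

(** The continuation is the halted machine, whose output law is the indicator of its string. On a
    point mass [D] the kernel identity then reads off [D']. *)
Lemma transforms_samples n c T s (z0 : bits n)
    (I I' : bits n -> store R -> Prop) D D' :
  I z0 s -> transforms c T I I' D D' ->
  (forall z, D z = (z == z0)%:R) ->
  (forall z s', I' z s' -> forall w, outputs w s' = (w == z)) ->
  samples_within c s D' T.
Proof.
move=> Iz0 [kap [h e]] ED hI'.
have hk z s' : I' z s' -> outcome ([::], s') 0 (fun w : bits n => (w == z)%:R).
  move=> /hI' E t /(@outcome_halted n s')[h1 h2].
  by split=> // w; rewrite h2 E.
have /(_ T) [|] := h z0 s Iz0 [::] 0%N (fun z w => (w == z)%:R) hk.
  by rewrite addn0.
move=> hhalt hsum; split=> // w; rewrite hsum.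
transitivity (\sum_z D z * kap (fun z w => (w == z)%:R) z w).
  rewrite (bigD1 z0) //= ED eqxx mul1r big1 ?addr0 // => z /negbTE ne.
  by rewrite ED ne mul0r.
rewrite e (bigD1 w) //= eqxx mulr1 big1 ?addr0 // => z.
by rewrite eq_sym => /negbTE ->; rewrite mulr0.
Qed.

End Machine.

(** * Variable elimination *)

(** Extending configurations to all of [nat] means that removing the last vertex changes the range
    of a product but no type. *)
Definition ext_ffun (T : Type) (t0 : T) m (f : {ffun 'I_m -> T}) (i : nat) : T :=
  if insub i is Some j then f j else t0.

Definition upd (T : Type) (f : nat -> T) (m : nat) (r : T) (i : nat) : T :=
  if i == m then r else f i.

Lemma ext_ffunE (T : Type) (t0 : T) m (f : {ffun 'I_m -> T}) (i : 'I_m) :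
  ext_ffun t0 f i = f i.
Proof. by rewrite /ext_ffun valK. Qed.

Lemma sum_ffunS (V : nmodType) (T : finType) (t0 : T) m (F : (nat -> T) -> V) :
  \sum_(f : {ffun 'I_m.+1 -> T}) F (ext_ffun t0 f) =
  \sum_(f : {ffun 'I_m -> T}) \sum_(r : T) F (upd (ext_ffun t0 f) m r).
Proof.
rewrite pair_big /=.
pose h (f : {ffun 'I_m.+1 -> T}) : {ffun 'I_m -> T} * T :=
  ([ffun i => f (widen_ord (leqnSn m) i)], f ord_max).
pose h' (p : {ffun 'I_m -> T} * T) : {ffun 'I_m.+1 -> T} :=
  [ffun i : 'I_m.+1 => upd (ext_ffun t0 p.1) m p.2 i].
have hK : cancel h h'.
  move=> f; apply/ffunP=> i; rewrite ffunE /upd /=; case: eqP => [e|ne].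
    by congr (f _); apply: val_inj.
  have lt_i : (i < m)%N by have := ltn_ord i; lia.
  rewrite /ext_ffun (insubT (fun i => (i < m)%N) lt_i) /= ffunE.
  by congr (f _); apply: val_inj.
have h'K : cancel h' h.
  move=> [f r]; congr (_, _); last by rewrite ffunE /upd eqxx.
  apply/ffunP=> i; rewrite !ffunE /upd /= ifF ?ext_ffunE //.
  by have := ltn_ord i; lia.
rewrite [RHS](reindex h) /=; last by exists h' => x _.
apply: eq_bigr => f _; congr F; apply/funext=> i; rewrite /upd /ext_ffun.
case: eqP => [->|ne].
  rewrite (insubT (fun i => (i < m.+1)%N) (ltnSn m)) /=.
  by congr (f _); apply: val_inj.
case: (ltnP i m) => [lt_i|le_i]; last by rewrite !insubN // -leqNgt; lia.
have lt_iS : (i < m.+1)%N by lia.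
rewrite (insubT (fun i => (i < m)%N) lt_i).
rewrite (insubT (fun i => (i < m.+1)%N) lt_iS) /= ffunE.
by congr (f _); apply: val_inj.
Qed.

Lemma prod_nat_eq (C : comPzSemiRingType) m a (x : nat -> C) :
  \prod_(0 <= j < m) (if j == a then x j else 1) = if (a < m)%N then x a else 1.
Proof. by rewrite -big_mkcond big_nat1_eq. Qed.

Section Elimination.
Variables (C : comNzRingType) (S : nat) (s0 : 'I_S) (n : nat).
Implicit Types (W : nat -> nat -> nat -> nat -> C) (A : nat -> nat -> bool).
Implicit Types sg : nat -> 'I_S.

(* Index n is a dummy vertex whose state is always 0: W j n carries the unary
   weight of vertex j, and W n n a scalar factor. *)
Definition weight m W sg : C :=
  W n n 0%N 0%N * \prod_(0 <= j < m) W j n (sg j) 0%N *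
  \prod_(0 <= l < m) \prod_(0 <= j < l) W j l (sg j) (sg l).

Definition partition_fun m W : C :=
  \sum_(f : {ffun 'I_m -> 'I_S}) weight m W (ext_ffun s0 f).

Definition linked A (v j : nat) : bool :=
  ((j < v)%N && A j v) || ((v < j)%N && A v j).

(** The second clause lets the dummy [n] stand for a missing neighbour: its weights towards a true
    vertex are 1. A single update formula then serves vertices with zero, one or two neighbours,
    landing in the scalar, a unary or a pair weight. *)
Definition elim_inv m A W : Prop :=
  [/\ forall j l s t, (j < l < m)%N -> ~~ A j l -> (s < S)%N -> (t < S)%N ->
        W j l s t = 1,
      forall v s t, (v < m)%N -> (s < S)%N -> (t < S)%N -> W n v s t = 1 &
      forall v, (v < m)%N -> (count (linked A v) (iota 0 m) <= 2)%N].

(** The vertices above [m] are gone when [m] is eliminated, so these are all its neighbours. They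
    come in increasing order, as pair weights are only read at [j < l]. *)
Definition lower_nbrs A m : seq nat := [seq j <- iota 0 m | A j m].

Lemma weightS m W sg r :
  weight m.+1 W (upd sg m r) =
  weight m W sg * (W m n r 0%N * \prod_(0 <= j < m) W j m (sg j) r).
Proof.
have sgm : upd sg m r m = r by rewrite /upd eqxx.
have sgl j : (j < m)%N -> upd sg m r j = sg j by rewrite /upd => ?; rewrite ifF //; lia.
rewrite /weight !big_nat_recr //= sgm.
have -> : \prod_(0 <= j < m) W j n (upd sg m r j) 0%N =
          \prod_(0 <= j < m) W j n (sg j) 0%N.
  by apply: eq_big_nat => j /andP[_ jm]; rewrite sgl.
have -> : \prod_(0 <= j < m) W j m (upd sg m r j) r =
          \prod_(0 <= j < m) W j m (sg j) r.
  by apply: eq_big_nat => j /andP[_ jm]; rewrite sgl.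
have -> : \prod_(0 <= l < m) \prod_(0 <= j < l)
             W j l (upd sg m r j) (upd sg m r l) =
          \prod_(0 <= l < m) \prod_(0 <= j < l) W j l (sg j) (sg l).
  apply: eq_big_nat => l /andP[_ lm]; apply: eq_big_nat => j /andP[_ jl].
  by rewrite !sgl //; apply: ltn_trans lm.
by ring.
Qed.

(** The modified cells [(a, b)] meet at most one of the three products in [weight]: the scalar if
    [a = b = n], the unary part if only [b = n], the pair part if [a < b < m]. The three
    conditionals are mutually exclusive because [m <= n]. *)
Lemma weight_mul m W W' (a b : nat) (X : nat -> nat -> C) sg : (m <= n)%N ->
  (forall j l s t, (j <= n)%N -> (l <= n)%N -> (s < S)%N -> (t < S)%N ->
     W' j l s t = W j l s t * (if (j == a) && (l == b) then X s t else 1)) ->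
  weight m W' sg = weight m W sg *
    ((if (a == n) && (b == n) then X 0%N 0%N else 1) *
     (if (b == n) && (a < m)%N then X (sg a) 0%N else 1) *
     (if (a < b < m)%N then X (sg a) (sg b) else 1)).
Proof.
move=> le_mn HW'; have S0 : (0 < S)%N by apply: leq_ltn_trans (ltn_ord s0).
rewrite /weight HW' // [n == a]eq_sym [n == b]eq_sym.
have -> : \prod_(0 <= j < m) W' j n (sg j) 0%N =
    \prod_(0 <= j < m) W j n (sg j) 0%N *
    (if (b == n) && (a < m)%N then X (sg a) 0%N else 1).
  transitivity (\prod_(0 <= j < m) (W j n (sg j) 0%N *
      if j == a then (if b == n then X (sg j) 0%N else 1) else 1)).
    apply: eq_big_nat => j /andP[_ jm].
    rewrite HW' //; last exact: leq_trans (ltnW jm) le_mn.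
    by rewrite [n == b]eq_sym; case: eqP; case: eqP.
  rewrite big_split prod_nat_eq; congr (_ * _).
  by case: (b == n); case: (a < m)%N.
have -> : \prod_(0 <= l < m) \prod_(0 <= j < l) W' j l (sg j) (sg l) =
    \prod_(0 <= l < m) \prod_(0 <= j < l) W j l (sg j) (sg l) *
    (if (a < b < m)%N then X (sg a) (sg b) else 1).
  transitivity (\prod_(0 <= l < m) (\prod_(0 <= j < l) W j l (sg j) (sg l) *
      if l == b then (if (a < l)%N then X (sg a) (sg l) else 1) else 1)).
    apply: eq_big_nat => l /andP[_ lm].
    transitivity (\prod_(0 <= j < l) (W j l (sg j) (sg l) *
        if j == a then (if l == b then X (sg j) (sg l) else 1) else 1)).
      apply: eq_big_nat => j /andP[_ jl].
      rewrite HW' //; [|lia|lia].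
      by case: eqP; case: eqP.
    rewrite big_split prod_nat_eq; congr (_ * _).
    by case: (l == b); case: (a < l)%N.
  rewrite big_split prod_nat_eq; congr (_ * _).
  by case: (a < b)%N => //=; case: (b < m)%N.
by ring.
Qed.

Lemma count_linked_lower A m :
  count (linked A m) (iota 0 m.+1) = size (lower_nbrs A m).
Proof.
rewrite size_filter -addn1 iotaD count_cat /= {2}/linked add0n ltnn /= !addn0.
apply: eq_in_count => j; rewrite mem_iota add0n /linked => /andP[_ jm].
by rewrite jm /= [(m < j)%N]ltnNge (ltnW jm) /= orbF.
Qed.

(* Deleting vertex m makes its two neighbours a and b adjacent, so the maximum
   degree does not increase. *)
Lemma elimination_step m A A' W W' :
  let ns := lower_nbrs A m in
  let a := nth n ns 0 in let b := nth n ns 1 in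
  (m < n)%N -> elim_inv m.+1 A W ->
  (forall j l, (j < l < m)%N -> A' j l = A j l || (j == a) && (l == b)) ->
  (forall j l s t, (j <= n)%N -> (l <= n)%N -> (s < S)%N -> (t < S)%N ->
     W' j l s t = W j l s t * (if (j == a) && (l == b) then
       \sum_(r < S) W m n r 0%N * W a m s r * W b m t r else 1)) ->
  partition_fun m W' = partition_fun m.+1 W /\ elim_inv m A' W'.
Proof.
move=> ns a b lt_mn [W1 Wn dg] HA' HW'.
have S0 : (0 < S)%N by apply: leq_ltn_trans (ltn_ord s0).
have ns_le2 : (size ns <= 2)%N by rewrite -count_linked_lower dg.
have ns_lt x : x \in ns -> (x < m)%N by rewrite mem_filter mem_iota => /andP[].
have ns_A x : x \in ns -> A x m by rewrite mem_filter => /andP[].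
have ns_sorted : sorted ltn ns.
  by apply: sorted_filter; [apply: ltn_trans|apply: iota_ltn_sorted].
have prod_ns (sg : nat -> 'I_S) (r : 'I_S) :
    \prod_(0 <= j < m) W j m (sg j) r = \prod_(j <- ns) W j m (sg j) r.
  rewrite big_filter /index_iota subn0 [RHS]big_mkcond /=.
  apply: eq_big_seq => j; rewrite mem_iota add0n => /andP[_ jm].
  by case: ifP => // /negbT nA; rewrite W1 // jm /=.
split.
  rewrite /partition_fun sum_ffunS; apply: eq_bigr => f _.
  set sg := ext_ffun s0 f.
  rewrite (weight_mul _ (ltnW lt_mn) HW').
  under [RHS]eq_bigr do rewrite weightS prod_ns.
  rewrite -big_distrr /=; congr (_ * _).
  move: ns_lt ns_sorted ns_le2; rewrite /a /b.
  case: {prod_ns ns_A a b HA' HW'} ns => [|x [|y [|//]]] /= ns_lt ns_s _.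
  - rewrite eqxx [(n < m)%N]ltnNge (ltnW lt_mn) ltnn /= !mulr1.
    by apply: eq_bigr => r _; rewrite big_nil !Wn // ?mulr1.
  - have xm : (x < m)%N by rewrite ns_lt // inE.
    rewrite eqxx [(n < m)%N]ltnNge (ltnW lt_mn) xm andbF /=.
    rewrite [x == n]ltn_eqF /=; last exact: ltn_trans lt_mn.
    rewrite mul1r mulr1; apply: eq_bigr => r _.
    by rewrite big_seq1 !Wn // mulr1.
  have xm : (x < m)%N by rewrite ns_lt // !inE eqxx.
  have ym : (y < m)%N by rewrite ns_lt // !inE eqxx orbT.
  rewrite [y == n]ltn_eqF /=; last exact: ltn_trans lt_mn.
  rewrite andbF !mul1r ym; move: ns_s; rewrite andbT => -> /=.
  by apply: eq_bigr => r _; rewrite big_cons big_seq1 mulrA.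
have an : (a <= n)%N.
  rewrite /a; case: (ltnP 0 (size ns)) => h; last by rewrite nth_default.
  exact: leq_trans (ltnW (ns_lt _ (mem_nth n h))) (ltnW lt_mn).
split.
- move=> j l s t jlm; rewrite HA' // negb_or => /andP[nA /negbTE nab] sS tS.
  rewrite HW' ?nab ?mulr1 ?W1 //; lia.
- move=> v s t vm sS tS; rewrite HW' ?Wn //; [|lia|lia].
  (* The cell [(n, v)] is never the updated one: padding fills the list of neighbours from the
     right, so [a = n] forces [b = n]. *)
  case: ifP => [/andP[/eqP na /eqP vb]|_]; last by rewrite mulr1.
  suff : (b == n) by rewrite -vb; lia.
  rewrite /b nth_default // leqNgt; apply/negP => h.
  by have := ns_lt _ (mem_nth n (ltnW h)); rewrite -/a -na ltnNge (ltnW lt_mn).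
move=> v vm; have := dg v (ltnW vm).
rewrite -[m.+1]addn1 iotaD count_cat /= add0n addn0 => dgv.
(* If [m <= b], which is the case of fewer than two neighbours, no edge below [m] is added. *)
case: (ltnP b m) => [bm|bm]; last first.
  apply: leq_trans dgv; apply: leq_trans (leq_addr _ _).
  rewrite leq_eqVlt; apply/orP; left; apply/eqP; apply: eq_in_count => j.
  rewrite mem_iota add0n /linked => /andP[_ jm].
  by congr (_ || _); case: ltnP => //= jv; rewrite HA' ?jv //;
    have := bm; case: (eqVneq _ b) => [<-|]; rewrite ?andbF ?orbF //; lia.
have sz : (1 < size ns)%N.
  by rewrite ltnNge; apply/negP => h; have := bm; rewrite /b nth_default //; lia.
have a_ns : a \in ns by rewrite mem_nth // ltnW.
have b_ns : b \in ns by rewrite mem_nth.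
have ab : (a < b)%N.
  by move: ns_sorted sz; rewrite /a /b; case: (ns) => [|x [|y l]] //= /andP[].
have am := ns_lt _ a_ns.
have hadj j : (j < m)%N -> linked A' v j =
    linked A v j || ((v == a) && (j == b) || (v == b) && (j == a)).
  move=> jm; rewrite /linked.
  case: (ltngtP j v) => [jv|vj|->]; rewrite ?orbF /=.
  - rewrite HA' ?jv //; congr (_ || _); rewrite andbC.
    have -> : (v == a) && (j == b) = false; last by [].
    by apply/negP => /andP[/eqP ? /eqP ?]; lia.
  - rewrite HA' ?vj //; congr (_ || _).
    have -> : (v == b) && (j == a) = false; last by rewrite orbF.
    by apply/negP => /andP[/eqP ? /eqP ?]; lia.
  symmetry; apply/negP => /orP[] /andP[/eqP ? /eqP ?]; lia.
(* Only an inequality, since [x] may already be linked to [v]. The extra 1 is paid by the lost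
   neighbour [m]. *)
have cadd (x : nat) : (count (predU (linked A v) (pred1 x)) (iota 0 m) <=
    count (linked A v) (iota 0 m) + 1)%N.
  apply: leq_trans (_ : count (linked A v) (iota 0 m) + count_mem x (iota 0 m) <= _)%N.
    by rewrite -count_predUI leq_addr.
  by rewrite leq_add2l count_uniq_mem ?iota_uniq // leq_b1.
case: (eqVneq v a) => [va|nva].
  apply: leq_trans dgv; rewrite {3}/linked va [(a < m)%N]am.
  rewrite [(m < a)%N]ltnNge (ltnW am) ns_A //= -va.
  apply: leq_trans (cadd b); rewrite leq_eqVlt; apply/orP; left; apply/eqP.
  apply: eq_in_count => j; rewrite mem_iota add0n => /andP[_ jm].
  by rewrite hadj // /= va eqxx [a == b]ltn_eqF // orbF.
case: (eqVneq v b) => [vb|nvb].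
  apply: leq_trans dgv; rewrite {3}/linked vb [(b < m)%N]bm.
  rewrite [(m < b)%N]ltnNge (ltnW bm) ns_A //= -vb.
  apply: leq_trans (cadd a); rewrite leq_eqVlt; apply/orP; left; apply/eqP.
  apply: eq_in_count => j; rewrite mem_iota add0n => /andP[_ jm].
  by rewrite hadj // /= (negbTE nva) vb eqxx.
apply: leq_trans dgv; apply: leq_trans (leq_addr _ _).
rewrite leq_eqVlt; apply/orP; left; apply/eqP.
apply: eq_in_count => j; rewrite mem_iota add0n => /andP[_ jm].
by rewrite hadj // (negbTE nva) (negbTE nvb) /= orbF.
Qed.

Lemma partition_fun0 W : partition_fun 0 W = W n n 0%N 0%N.
Proof.
rewrite /partition_fun (eq_bigr (fun=> W n n 0%N 0%N)); last first.
  by move=> f _; rewrite /weight !big_geq // !mulr1.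
by rewrite sumr_const card_ffun !card_ord expn0.
Qed.

End Elimination.

(** * The program computing an amplitude *)

Section ComplexCells.
Local Open Scope complex_scope.
Variable R : realType.
Implicit Types s : store R.

Lemma neval_rset s a e v x : neval (rset s a e v) x = neval s x.
Proof. by elim: x => //= [a' x ->|x -> y ->|x -> y ->]. Qed.

Fixpoint rfree (a : nat) (r : rexpr) : bool :=
  match r with
  | RZero | ROne => true
  | RGet a' _ => a' != a
  | RAdd r1 r2 | RSub r1 r2 | RMul r1 r2 | RDiv r1 r2 => rfree a r1 && rfree a r2
  end.

Lemma reval_rset s a e v r : rfree a r -> reval (rset s a e v) r = reval s r.
Proof.
elim: r => //= [a' x /negbTE ne|r1 h1 r2 h2|r1 h1 r2 h2|r1 h1 r2 h2|r1 h1 r2 h2];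
  first by rewrite neval_rset /update ne.
all: by move=> /andP[/h1 -> /h2 ->].
Qed.

Definition cexpr := (rexpr * rexpr)%type.

Definition cget (ar ai : nat) (e : nexpr) : cexpr := (RGet ar e, RGet ai e).

Definition caddE (x y : cexpr) : cexpr := (RAdd x.1 y.1, RAdd x.2 y.2).

Definition cmulE (x y : cexpr) : cexpr :=
  (RSub (RMul x.1 y.1) (RMul x.2 y.2), RAdd (RMul x.1 y.2) (RMul x.2 y.1)).

Definition ceval s (x : cexpr) : R[i] := reval s x.1 +i* reval s x.2.

Lemma ceval_cmulE s x y : ceval s (cmulE x y) = ceval s x * ceval s y.
Proof. by []. Qed.

Lemma ceval_caddE s x y : ceval s (caddE x y) = ceval s x + ceval s y.
Proof. by []. Qed.

Definition cmem s (ar ai e : nat) : R[i] := rmem s ar e +i* rmem s ai e.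

Lemma ceval_cget s ar ai e : ceval s (cget ar ai e) = cmem s ar ai (neval s e).
Proof. by []. Qed.

(** Both components of [x] may read the cell being assigned, so the new real part is parked in array
    8 until the imaginary part has been computed. *)
Definition CSet (ar ai : nat) (e : nexpr) (x : cexpr) : cmd :=
  Seq (RSet 8 (NConst 0) x.1)
    (Seq (RSet ai e x.2) (RSet ar e (RGet 8 (NConst 0)))).

Lemma tc_cset ar ai e x s T (Q : store R -> Prop) :
  (5 <= T)%N -> rfree 8 x.2 -> uniq [:: 8%N; ar; ai] ->
  (forall s', framed (nwrites (CSet ar ai e x)) (rwrites (CSet ar ai e x)) s s' ->
     (forall e', cmem s' ar ai e' =
        if e' == neval s e then ceval s x else cmem s ar ai e') -> Q s') ->
  tc (CSet ar ai e x) s T Q.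
Proof.
move=> le_T fx /and3P[]; rewrite !inE negb_or => /andP[/negbTE n1 /negbTE n2].
move=> /negbTE n3 _ hQ.
pose s1 := rset s 8 0 (reval s x.1).
pose s2 := rset s1 ai (neval s1 e) (reval s1 x.2).
pose s3 := rset s2 ar (neval s2 e) (reval s2 (RGet 8 (NConst 0))).
have ex : exec (CSet ar ai e x) s 5 s3.
  apply: (ExecSeq (t1 := 1) (t2 := 3)); first exact: ExecRSet.
  by apply: (ExecSeq (t1 := 1) (t2 := 1)); exact: ExecRSet.
exists s3, 5%N; split=> //; apply: hQ; first exact: framed_exec ex.
move=> e'; rewrite /cmem /s3 /s2 /s1 !neval_rset (reval_rset _ _ _ fx) /=.
rewrite /update !eqxx [ai == ar]eq_sym n3 [ar == 8%N]eq_sym [ai == 8%N]eq_sym n1 n2 /=.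
by case: eqP.
Qed.

End ComplexCells.

Definition eqT (x y : nexpr) : test := NLe (NAdd (NSub x y) (NSub y x)) (NConst 0).

Lemma teval_eqT (R : realType) (s : store R) x y :
  teval s (eqT x y) = (neval s x == neval s y).
Proof. by rewrite /=; lia. Qed.

(* Natural arrays: 3 and 4 hold the multiples of the radix B and of n, 5 and 6
   the halves and parities, 7 the current adjacency; cell 0 of the arrays from
   10 on holds a scalar.  Real arrays: 4 and 5 hold the weights, 6 and 7 a
   complex scalar, 8 a temporary value. *)
Definition nE : nexpr := NGet 0 (NConst 0).
Definition sizeE : nexpr := nvar 14.
Definition layerE : nexpr := nvar 15.
Definition qubitE : nexpr := nvar 16.

Definition pairE (x y : nexpr) : nexpr := NAdd (NGet 3 x) y.

Definition addrE (j l x y : nexpr) : nexpr := pairE (pairE (pairE j l) x) y.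

Definition gateE (k j l a b : nexpr) : nexpr :=
  let i := NAdd (NGet 4 (NAdd (NGet 4 k) j)) l in
  NAdd (NAdd (NAdd i i) (NAdd i i)) (NAdd (NAdd a a) b).

Definition accE : cexpr := cget 6 7 (NConst 0).

Definition weightE (j l x y : nexpr) : cexpr := cget 4 5 (addrE j l x y).

Definition MulAcc (x : cexpr) : cmd := CSet 6 7 (NConst 0) (cmulE accE x).

Definition parityE (x : nexpr) : nexpr := NGet 6 x.

Definition Mix (y : nexpr) : cmd :=
  If (eqT (parityE (nvar 25)) y)
    (MulAcc (RGet 0 (nvar 24), RZero)) (MulAcc (RZero, RGet 1 (nvar 24))).

Definition NoMix (y : nexpr) : cmd :=
  If (eqT (parityE (nvar 25)) y) Skip (MulAcc (RZero, RZero)).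

(** Variable 25 holds the path of the qubit shifted right by the current layer, variable 24: its
    parity is the current bit, the parity of its half the next one. In the last layer there is no
    next bit; the path ends in the output bit, through a mixing gate or a Kronecker delta according
    to whether the truncated circuit contains that gate. *)
Definition Unary : cmd :=
  Seq (MulAcc (cget 2 3 (gateE (nvar 24) (nvar 20) (nvar 20)
                (parityE (nvar 25)) (parityE (nvar 25)))))
    (If (NLe (NAdd (nvar 24) (NConst 1)) layerE)
      (Mix (parityE (NGet 5 (nvar 25))))
      (If (NLe (nvar 20) qubitE) (Mix (NGet 2 (nvar 20)))
                                 (NoMix (NGet 2 (nvar 20))))).

Definition LayerFactor : cmd :=
  Seq (If (NLe nE (nvar 20)) Skip
        (If (NLe nE (nvar 21)) Unary
          (MulAcc (cget 2 3 (gateE (nvar 24) (nvar 20) (nvar 21)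
                    (parityE (nvar 25)) (parityE (nvar 26)))))))
    (Seq (NSet 25 (NConst 0) (NGet 5 (nvar 25)))
         (NSet 26 (NConst 0) (NGet 5 (nvar 26)))).

Definition Entry : cmd :=
  Seq (CSet 6 7 (NConst 0) (ROne, RZero))
  (Seq (NSet 25 (NConst 0) (nvar 22))
  (Seq (NSet 26 (NConst 0) (nvar 23))
  (Seq (For 24 (NAdd layerE (NConst 1)) LayerFactor)
       (CSet 4 5 (addrE (nvar 20) (nvar 21) (nvar 22) (nvar 23)) accE)))).

(** The graph is copied because elimination adds edges and later amplitudes need the original one.
    In radix [n] the cells of the dummy vertex would collide with others; in radix [B] they do
    not. *)
Definition InitPair : cmd :=
  Seq (NSet 7 (pairE (nvar 20) (nvar 21)) (NGet 1 (NAdd (NGet 4 (nvar 20)) (nvar 21))))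
      (For 22 sizeE (For 23 sizeE Entry)).

Definition InitWeights : cmd :=
  For 20 (NAdd nE (NConst 1)) (For 21 (NAdd nE (NConst 1)) InitPair).

Definition ScanNeighbours : cmd :=
  For 20 (nvar 27)
    (If (NLe (NConst 1) (NGet 7 (pairE (nvar 20) (nvar 27))))
        (If (NLe nE (nvar 28)) (NSet 28 (NConst 0) (nvar 20))
                               (NSet 29 (NConst 0) (nvar 20)))
        Skip).

Definition UpdateWeight : cmd :=
  Seq (CSet 6 7 (NConst 0) (RZero, RZero))
  (Seq (For 32 sizeE
         (CSet 6 7 (NConst 0) (caddE accE
           (cmulE (cmulE (weightE (nvar 27) nE (nvar 32) (NConst 0))
                         (weightE (nvar 28) (nvar 27) (nvar 22) (nvar 32)))
                  (weightE (nvar 29) (nvar 27) (nvar 23) (nvar 32))))))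
       (CSet 4 5 (addrE (nvar 28) (nvar 29) (nvar 22) (nvar 23))
          (cmulE (weightE (nvar 28) (nvar 29) (nvar 22) (nvar 23)) accE))).

Definition Eliminate : cmd :=
  Seq (NSet 27 (NConst 0) (NSub (NSub nE (NConst 1)) (nvar 33)))
  (Seq (NSet 28 (NConst 0) nE)
  (Seq (NSet 29 (NConst 0) nE)
  (Seq ScanNeighbours
  (Seq (NSet 7 (pairE (nvar 28) (nvar 29)) (NConst 1))
       (For 22 sizeE (For 23 sizeE UpdateWeight)))))).

Definition Amplitude : cmd := Seq InitWeights (For 33 nE Eliminate).

(** Once every vertex is eliminated, the whole partition function sits in this scalar cell. *)
Definition amplitudeE : cexpr := weightE nE nE (NConst 0) (NConst 0).

Lemma digits_inj B a b a' b' : (b < B)%N -> (b' < B)%N ->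
  (a * B + b == a' * B + b')%N = (a == a') && (b == b').
Proof.
move=> hb hb'; have B0 : (0 < B)%N by apply: leq_ltn_trans hb.
apply/eqP/andP => [e|[/eqP -> /eqP ->]] //.
split; apply/eqP.
  by have := congr1 (divn^~ B) e; rewrite !divnMDl // !divn_small // !addn0.
by have := congr1 (modn^~ B) e; rewrite !modnMDl !modn_small.
Qed.

Definition addr (B j l x y : nat) : nat := (((j * B + l) * B + x) * B + y)%N.

Lemma addr_eq B j l x y j' l' x' y' :
  (l < B)%N -> (x < B)%N -> (y < B)%N -> (l' < B)%N -> (x' < B)%N -> (y' < B)%N ->
  (addr B j l x y == addr B j' l' x' y') =
  [&& j == j', l == l', x == x' & y == y'].
Proof. by move=> *; rewrite /addr !digits_inj // -!andbA. Qed.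

(** A number below [2 ^ (K + 1)] encodes the path of a qubit: digit [k] is its bit on entering layer
    [k]. *)
Definition bit (x k : nat) : bool := odd (iter k half x).

Lemma iter_half_le k x : (iter k half x <= x)%N.
Proof. by elim: k => //= k IH; apply: leq_trans IH; rewrite leq_half_double; lia. Qed.

(** * Initial weights of the elimination and the code that fills them in *)

Section AmplitudeSpec.
Local Open Scope complex_scope.
Variable R : realType.
Implicit Types s : store R.

Definition gate_cell (n k j l a b : nat) : nat :=
  (((k * n + j) * n + l) * 4 + (a * 2 + b))%N.

Definition mem_gate s (n k j l a b : nat) : R[i] := cmem s 2 3 (gate_cell n k j l a b).

Definition mem_mix s (k a b : nat) : R[i] :=
  if a == b then rmem s 0 k +i* 0 else 0 +i* rmem s 1 k.

(** The circuit meant here contains the layers before [K], the phase gates of layer [K] and its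
    mixing gates up to qubit [J]. The row of the dummy vertex is 1, as [elim_inv] demands. *)
Definition mem_factor s (n K J j l x y k : nat) : R[i] :=
  if (n <= j)%N then 1 else
  if (n <= l)%N then
    mem_gate s n k j j (bit x k) (bit x k) *
    (if (k < K)%N then mem_mix s k (bit x k) (bit x k.+1) else
     if (j <= J)%N then mem_mix s k (bit x k) (nmem s 2 j)
     else (bit x k == nmem s 2 j :> nat)%:R)
  else mem_gate s n k j l (bit x k) (bit y k).

Definition mem_weight s (n K J j l x y : nat) : R[i] :=
  \prod_(0 <= k < K.+1) mem_factor s n K J j l x y k.

(** The range [B ^ 3] comes from [addrE]: its last multiplication by the radix is applied to a
    number with three digits in radix [B], and no other table lookup goes higher. *)
Record env s (n B K J : nat) : Prop := Env {
  env_n : nmem s 0 0 = n;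
  env_mulB : forall x, (x < B ^ 3)%N -> nmem s 3 x = (x * B)%N;
  env_muln : forall x, (x < B ^ 3)%N -> nmem s 4 x = (x * n)%N;
  env_half : forall x, (x < B ^ 3)%N -> nmem s 5 x = x./2;
  env_odd : forall x, (x < B ^ 3)%N -> nmem s 6 x = odd x;
  env_size : nmem s 14 0 = (2 ^ K.+1)%N;
  env_layer : nmem s 15 0 = K;
  env_qubit : nmem s 16 0 = J;
  env_nB : (n < B)%N;
  env_sizeB : (2 ^ K.+1 <= B)%N }.

Lemma env_framed L L' s s' n B K J :
  framed L L' s s' -> all (fun a => a \notin L) [:: 0; 3; 4; 5; 6; 14; 15; 16]%N ->
  env s n B K J -> env s' n B K J.
Proof.
move=> [fr _] /and5P[h0 h3 h4 h5 /and5P[h6 h14 h15 h16 _]].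
case=> en eB em eh eo es el eq nB sB.
by constructor=> // [|x xB|x xB|x xB|x xB|||]; rewrite fr //; auto.
Qed.

Section Env.
Variables (s : store R) (n B K J : nat).
Hypothesis E : env s n B K J.

Lemma env_layerB : (K.+1 < B)%N.
Proof. by apply: leq_trans (env_sizeB E); apply: ltn_expl. Qed.

Lemma ltB3 x : (x < B * B)%N -> (x < B ^ 3)%N.
Proof.
move=> h; apply: leq_trans h _; rewrite expnS leq_mul2l; apply/orP; right.
by rewrite expnS expn1 leq_pmull //; have := env_nB E; lia.
Qed.

Lemma neval_pairE ej el j l : neval s ej = j -> neval s el = l -> (j <= n)%N ->
  neval s (pairE ej el) = (j * B + l)%N.
Proof.
move=> /= -> -> jn; rewrite (env_mulB E) //; apply: ltB3.
by have := env_nB E; nia.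
Qed.

Lemma neval_addrE ej el ex ey j l x y :
  neval s ej = j -> neval s el = l -> neval s ex = x -> neval s ey = y ->
  (j <= n)%N -> (l <= n)%N -> (x < 2 ^ K.+1)%N ->
  neval s (addrE ej el ex ey) = addr B j l x y.
Proof.
move=> hj hl hx hy jn ln xS; have := neval_pairE hj hl jn => /=.
have nB := env_nB E; have xB := leq_trans xS (env_sizeB E).
move=> ->; rewrite hx hy.
have b1 : (j * B + l < B * B)%N by nia.
rewrite (env_mulB E (ltB3 b1)) (env_mulB E) //.
by rewrite !expnS expn0 muln1; nia.
Qed.

Lemma neval_gateE ek ej el ea eb k j l a b :
  neval s ek = k -> neval s ej = j -> neval s el = l ->
  neval s ea = a -> neval s eb = b -> (k <= K)%N -> (j < n)%N ->
  neval s (gateE ek ej el ea eb) = gate_cell n k j l a b.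
Proof.
move=> /= -> -> -> -> -> kK jn; have KB := env_layerB; have nB := env_nB E.
have k3 : (k < B ^ 3)%N by apply: ltB3; nia.
have kj3 : (k * n + j < B ^ 3)%N by apply: ltB3; nia.
by rewrite (env_muln E k3) (env_muln E kj3) /gate_cell; lia.
Qed.

Lemma env_bits k x : (x < 2 ^ K.+1)%N -> nmem s 25 0 = iter k half x ->
  nmem s 6 (nmem s 25 0) = bit x k /\
  nmem s 5 (nmem s 25 0) = iter k.+1 half x.
Proof.
move=> xS ->; have h : (iter k half x < B ^ 3)%N.
  apply: ltB3; have := iter_half_le k x; have := env_sizeB E; nia.
by rewrite (env_odd E h) (env_half E h).
Qed.

End Env.

Lemma mem_factor_framed L L' s s' n K J j l x y k : framed L L' s s' ->
  2%N \notin L -> all (fun a => a \notin L') [:: 0; 1; 2; 3]%N ->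
  mem_factor s' n K J j l x y k = mem_factor s n K J j l x y k.
Proof.
move=> [fn fr] h2 /and5P[r0 r1 r2 r3 _].
by rewrite /mem_factor /mem_gate /mem_mix /cmem !fn // !fr.
Qed.

Lemma mem_weight_framed L L' s s' n K J j l x y : framed L L' s s' ->
  2%N \notin L -> all (fun a => a \notin L') [:: 0; 1; 2; 3]%N ->
  mem_weight s' n K J j l x y = mem_weight s n K J j l x y.
Proof.
by move=> fr h2 hr; apply: eq_bigr => k _; rewrite (mem_factor_framed _ _ _ _ _ _ _ _ fr).
Qed.

Lemma tc_mulacc (x : cexpr) s T (Q : store R -> Prop) :
  (5 <= T)%N -> rfree 8 x.1 -> rfree 8 x.2 ->
  (forall s', framed (nwrites (MulAcc x)) (rwrites (MulAcc x)) s s' ->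
     cmem s' 6 7 0 = cmem s 6 7 0 * ceval s x -> Q s') ->
  tc (MulAcc x) s T Q.
Proof.
move=> le_T h1 h2 hQ; apply: tc_cset => //; first by rewrite /= h1 h2.
by move=> s' fr' h; apply: hQ fr' _; rewrite h eqxx.
Qed.

Lemma tc_mix y s k : nmem s 24 0 = k ->
  tc (Mix y) s 6 (fun s' => cmem s' 6 7 0 =
    cmem s 6 7 0 * mem_mix s k (nmem s 6 (nmem s 25 0)) (neval s y)).
Proof.
move=> kE; apply: (tc_if (T := 5)) => //; rewrite teval_eqT /mem_mix /= => h.
  by apply: tc_mulacc => // s' _ ->; rewrite h /ceval /= kE.
apply: tc_mulacc => // s' _ ->.
by rewrite (negbTE h) /ceval /= kE.
Qed.

Lemma tc_nomix y s :
  tc (NoMix y) s 6 (fun s' => cmem s' 6 7 0 =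
    cmem s 6 7 0 * (nmem s 6 (nmem s 25 0) == neval s y)%:R).
Proof.
apply: (tc_if (T := 5)) => //; rewrite teval_eqT /= => h.
  by apply: tc_skip => //; rewrite h mulr1.
by apply: tc_mulacc => // s' _ ->; rewrite (negbTE h).
Qed.

Lemma tc_layer s n B K J j l x y k : env s n B K J ->
  nmem s 20 0 = j -> nmem s 21 0 = l -> nmem s 24 0 = k ->
  nmem s 25 0 = iter k half x -> nmem s 26 0 = iter k half y ->
  (k <= K)%N -> (x < 2 ^ K.+1)%N -> (y < 2 ^ K.+1)%N ->
  tc LayerFactor s 40 (fun s' =>
    [/\ nmem s' 25 0 = iter k.+1 half x, nmem s' 26 0 = iter k.+1 half y &
        cmem s' 6 7 0 = cmem s 6 7 0 * mem_factor s n K J j l x y k]).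
Proof.
move=> E hj hl hk hx hy kK xS yS.
have [bx hx'] := env_bits E xS hx.
have y3 : (iter k half y < B ^ 3)%N.
  apply: (ltB3 E); have := iter_half_le k y; have := env_sizeB E; nia.
have by' : nmem s 6 (nmem s 26 0) = bit y k by rewrite hy (env_odd E).
have hy' : nmem s 5 (nmem s 26 0) = iter k.+1 half y by rewrite hy (env_half E).
apply: (tc_seq (T1 := 20) (T2 := 3)) => //.
apply: (tc_conseq (T := 20) (Q := fun s' => cmem s' 6 7 0 =
    cmem s 6 7 0 * mem_factor s n K J j l x y k)) => //; last first.
  move=> s1 [fn _] acc1; apply: (tc_seq (T1 := 1) (T2 := 1)) => //.
  apply: tc_nset => //; apply: tc_nset => //=.
  by rewrite /update /= !fn // hx' hy'.
apply: (tc_if (T := 19)) => //=; rewrite (env_n E) hj => hnj.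
  by apply: tc_skip => //; rewrite /mem_factor hnj mulr1.
have jn : (j < n)%N by rewrite ltnNge.
apply: (tc_if (T := 18)) => //=; rewrite (env_n E) hl => hnl; last first.
  apply: tc_mulacc => // s' _ ->.
  rewrite /mem_factor (negbTE hnj) (negbTE hnl) ceval_cget.
  by rewrite (neval_gateE E (k := k) (j := j) (l := l) (a := bit x k) (b := bit y k)).
apply: (tc_seq (T1 := 5) (T2 := 12)) => //.
apply: tc_mulacc => // s1 fr1.
have E1 := env_framed fr1 isT E.
rewrite ceval_cget.
rewrite (neval_gateE E (k := k) (j := j) (l := j) (a := bit x k) (b := bit x k)) //.
move=> acc1; have [fn1 fr1'] := fr1.
rewrite /mem_factor (negbTE hnj) hnl mulrA -/(mem_gate s n k j j _ _).
apply: (tc_if (T := 11)) => //=; rewrite (env_layer E1) fn1 // hk addn1 => hkK.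
  rewrite hkK; apply: tc_conseq (tc_mix _ (k := k) _) _ _ => //; first by rewrite fn1.
  move=> s2 _ ->; rewrite acc1 /mem_mix !fr1' //= !fn1 // bx hx'.
  rewrite (env_odd E) //.
  apply: (ltB3 E); have := iter_half_le k.+1 x; have := env_sizeB E; nia.
rewrite (negbTE hkK).
apply: (tc_if (T := 10)) => //=; rewrite (env_qubit E1) fn1 // hj => hjJ.
  rewrite hjJ; apply: tc_conseq (tc_mix _ (k := k) _) _ _ => //; first by rewrite fn1.
  by move=> s2 _ ->; rewrite acc1 /mem_mix !fr1' //= !fn1 // bx hj.
rewrite (negbTE hjJ); apply: tc_conseq (tc_nomix _ _) _ _ => //.
by move=> s2 _ ->; rewrite acc1 /= !fn1 // bx hj.
Qed.

Lemma tc_entry s n B K J j l x y : env s n B K J ->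
  nmem s 20 0 = j -> nmem s 21 0 = l -> nmem s 22 0 = x -> nmem s 23 0 = y ->
  (j <= n)%N -> (l <= n)%N -> (x < 2 ^ K.+1)%N -> (y < 2 ^ K.+1)%N ->
  tc Entry s (100 * B) (fun s' => forall e, cmem s' 4 5 e =
    if e == addr B j l x y then mem_weight s n K J j l x y else cmem s 4 5 e).
Proof.
move=> E hj hl hx hy jn ln xS yS; have KB := env_layerB E.
apply: (tc_seq (T1 := 5) (T2 := 60 * B)); first by lia.
apply: tc_cset => // s1 fr1 acc1.
apply: (tc_seq (T1 := 1) (T2 := 57 * B)); first by lia.
apply: tc_nset => //; apply: (tc_seq (T1 := 1) (T2 := 54 * B)); first by lia.
apply: tc_nset => //; set s2 := nset _ _ _ _.
have fr2 : framed [:: 25; 26]%N [:: 8; 7; 6]%N s s2.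
  split=> a e; last exact: fr1.2.
  rewrite !inE negb_or => /andP[/negbTE h1 /negbTE h2].
  by rewrite /s2 /= /update h1 h2 /= fr1.1.
have E2 := env_framed fr2 isT E; have [fn2 fm2] := fr2.
apply: (tc_seq (T1 := 46 * B) (T2 := 5)); first by lia.
apply: (tc_conseq (T := 46 * B)); [|exact: leqnn|].
  apply: (tc_for (N := K.+1) (T := 40) (I := fun k s' =>
      [/\ nmem s' 25 0 = iter k half x, nmem s' 26 0 = iter k half y &
        cmem s' 6 7 0 = \prod_(0 <= i < k) mem_factor s n K J j l x y i])) => //.
  - by move=> s' [fn _]; rewrite /= fn // (env_layer E2) addn1.
  - rewrite big_geq //; split.
    + by rewrite /s2 /= /update /= fr1.1 // hx.
    + by rewrite /s2 /= /update /= fr1.1 // hy.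
    by have := acc1 0%N; rewrite eqxx.
  - move=> k s' kK fr hk [i1 i2 i3].
    have E' := env_framed fr isT E2.
    have hj' : nmem s' 20 0 = j by rewrite fr.1 // fn2.
    have hl' : nmem s' 21 0 = l by rewrite fr.1 // fn2.
    apply: tc_conseq (tc_layer E' hj' hl' hk i1 i2 _ xS yS) _ _ => //.
    move=> s'' _ [h1 h2 h3]; split=> //.
    rewrite h3 i3 big_nat_recr //=; congr (_ * _).
    by rewrite (mem_factor_framed _ _ _ _ _ _ _ _ fr) //
               (mem_factor_framed _ _ _ _ _ _ _ _ fr2).
  by nia.
move=> s3 _ [fr3 [_ _ acc3]].
have E3 := env_framed fr3 isT E2.
apply: tc_cset => // s4 fr4 w4 e.
rewrite w4 ceval_cget.
rewrite (neval_addrE E3 (j := j) (l := l) (x := x) (y := y)) //=;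
  try by rewrite fr3.1 // fn2.
case: eqP => // _; rewrite /cmem /= !fr3.2 // !fm2 //.
Qed.

End AmplitudeSpec.

Lemma framed_step (R : realType) L L' M M' (s0 s1 s2 : store R) :
  framed L L' s0 s1 -> framed M M' s1 s2 -> all (mem L) M && all (mem L') M' ->
  framed L L' s0 s2.
Proof.
move=> fr1 fr2 /andP[/allP h1 /allP h2].
by apply: framed_trans fr1 _; apply: framed_sub fr2.
Qed.

(** Source of the constants below: a loop of at most [B] rounds turns a bound [a * B ^ k] into
    [(a + 6) * B ^ k.+1], as in 100, 106, 112 or 40, 46, 52. *)
Lemma for_time N B T c : (N <= B)%N -> (0 < B)%N -> (3 <= c)%N ->
  (T + 6 <= c)%N -> (N * (T + 3) + 3 <= c * B)%N.
Proof. by nia. Qed.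

Section Transfer.
Variables (C : comNzRingType) (S : nat) (s0 : 'I_S) (n : nat).
Implicit Types (W : nat -> nat -> nat -> nat -> C) (A : nat -> nat -> bool).

Definition eq_weights W W' : Prop := forall j l x y,
  (j <= n)%N -> (l <= n)%N -> (x < S)%N -> (y < S)%N -> W j l x y = W' j l x y.

Lemma partition_fun_eq m W W' : (m <= n)%N -> eq_weights W W' ->
  partition_fun s0 n m W = partition_fun s0 n m W'.
Proof.
move=> le_mn eW; apply: eq_bigr => f _.
(* Congruence of [weight] is the case of a trivial factor in [weight_mul]. *)
rewrite (weight_mul (W := W') (a := 0) (b := 0) (X := fun _ _ => 1)
  s0 (ext_ffun s0 f) le_mn).
  by rewrite !if_same !mulr1.
by move=> j l x y *; rewrite if_same mulr1 eW.
Qed.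

Lemma elim_inv_eq m A A' W W' : (m <= n)%N -> eq_weights W W' ->
  (forall j l, (j < l < m)%N -> A j l = A' j l) ->
  elim_inv S n m A W -> elim_inv S n m A' W'.
Proof.
move=> le_mn eW eA [h1 h2 h3]; split.
- by move=> j l x y jl nA xS yS; rewrite -eW ?h1 ?eA //; lia.
- by move=> v x y vm xS yS; rewrite -eW ?h2 //; lia.
move=> v vm; have := h3 v vm; congr (_ <= 2)%N.
apply: eq_in_count => j; rewrite mem_iota add0n /linked => /andP[_ jm].
by congr (_ || _); case: ltnP => //= lt; rewrite eA // lt.
Qed.

End Transfer.

(** * Correctness and running time of the elimination program *)

Section AmplitudeCorrect.
Local Open Scope complex_scope.
Variable R : realType.
Implicit Types s : store R.

Definition mem_entry B s (j l x y : nat) : R[i] := cmem s 4 5 (addr B j l x y).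

Definition mem_adj B s (j l : nat) : bool := (0 < nmem s 7 (j * B + l))%N.

Section Init.
Variables (s0 : store R) (n B K J : nat).
Hypothesis E0 : env s0 n B K J.
Local Notation S := (2 ^ K.+1)%N.

(** One lexicographic position serves as the invariant of all four nested loops. Leaving an inner
    loop merely renames the position, from the end of one row to the start of the next. *)
Definition lex4 (j0 l0 x0 y0 j l x y : nat) : bool :=
  (j < j0)%N || (j == j0) && ((l < l0)%N || (l == l0) && ((x < x0)%N ||
     (x == x0) && (y < y0)%N)).

Definition filled j0 l0 x0 y0 s : Prop := forall j l x y,
  (j <= n)%N -> (l <= n)%N -> (x < S)%N -> (y < S)%N ->
  lex4 j0 l0 x0 y0 j l x y -> mem_entry B s j l x y = mem_weight s0 n K J j l x y.

Definition copied j0 l0 s : Prop := forall j l, (j < n)%N -> (l < n)%N ->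
  (j < j0)%N || (j == j0) && (l < l0)%N ->
  nmem s 7 (j * B + l) = nmem s0 1 (j * n + l).

Local Notation FR := (framed (nwrites InitWeights) (rwrites InitWeights)).

Lemma tc_entry_filled s j l x y : FR s0 s ->
  nmem s 20 0 = j -> nmem s 21 0 = l -> nmem s 22 0 = x -> nmem s 23 0 = y ->
  (j <= n)%N -> (l <= n)%N -> (x < S)%N -> (y < S)%N ->
  filled j l x y s -> tc Entry s (100 * B) (filled j l x y.+1).
Proof.
move=> fr hj hl hx hy jn ln xS yS F.
have E := env_framed fr isT E0.
have nB := env_nB E; have SB := env_sizeB E.
apply: tc_conseq (tc_entry E hj hl hx hy jn ln xS yS) _ _ => // s' _ Hs'.
move=> j' l' x' y' jn' ln' xS' yS' L; rewrite /mem_entry Hs'.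
rewrite addr_eq; try lia.
case: ifP => [/and4P[/eqP -> /eqP -> /eqP -> /eqP ->]|ne].
  exact: mem_weight_framed fr _ _.
by apply: F => //; move: L ne; rewrite /lex4; lia.
Qed.

Lemma tc_init_pair s j l : FR s0 s ->
  nmem s 20 0 = j -> nmem s 21 0 = l -> (j <= n)%N -> (l <= n)%N ->
  filled j l 0 0 s -> copied j l s ->
  tc InitPair s (120 * B ^ 3)
     (fun s' => filled j l.+1 0 0 s' /\ copied j l.+1 s').
Proof.
move=> fr hj hl jn ln F Cp; have E := env_framed fr isT E0.
have nB := env_nB E; have SB := env_sizeB E; have B0 : (0 < B)%N by lia.
have B3 : (0 < B ^ 3)%N by rewrite expn_gt0 B0.
have B2 : (0 < B ^ 2)%N by rewrite expn_gt0 B0.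
apply: (tc_seq (T1 := 1) (T2 := 112 * B ^ 3)); first by lia.
apply: tc_nset => //; rewrite (neval_pairE E (ej := nvar 20) (el := nvar 21) hj hl jn) /=.
rewrite hj hl (env_muln E); last by apply: (ltB3 E); nia.
set s1 := nset _ _ _ _.
have fr1 : FR s0 s1.
  have [fn fm] := fr; split=> // a e aL; rewrite -fn // /s1 /= /update.
  by case: eqP aL => // ->.
have F1 : filled j l 0 0 s1 by [].
have Cp1 : copied j l.+1 s1.
  move=> j' l' jn' ln' h; rewrite /s1 /= /update eqxx /=.
  rewrite digits_inj; [|lia|lia].
  case: ifP => [/andP[/eqP -> /eqP ->]|ne]; first by rewrite fr.1.
  by apply: Cp => //; move: h ne; lia.
apply: (tc_conseq (T := 112 * B ^ 3)); [|exact: leqnn|]; last first.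
  move=> s2 fr2 F2; split; first exact: F2.
  by move=> j' l' jn' ln' h; rewrite fr2.1 // Cp1.
apply: (tc_conseq (T := 112 * B ^ 3) (Q := fun s' =>
  framed (22 :: nwrites (For 23 sizeE Entry)) (rwrites (For 23 sizeE Entry)) s1 s'
  /\ filled j l S 0 s')); [|exact: leqnn|]; last first.
  move=> s2 _ [_ F2] j' l' x' y' jn' ln' xS yS L; apply: F2 => //.
  by move: L; rewrite /lex4; lia.
apply: (tc_for (T := 106 * B ^ 2) (I := fun x s' => filled j l x 0 s')) => //.
- by move=> s' fr'; rewrite /= fr'.1 // fr1.1 // (env_size E0).
- move=> x s2 xS fr2 hx F2.
  have fr2' : FR s0 s2 by apply: framed_step fr1 fr2 _.
  apply: (tc_conseq (T := 106 * B ^ 2) (Q := fun s' =>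
    framed (23 :: nwrites Entry) (rwrites Entry) s2 s'
    /\ filled j l x S s')); [|exact: leqnn|]; last first.
    move=> s3 _ [_ F3] j' l' x' y' jn' ln' xS' yS L; apply: F3 => //.
    by move: L; rewrite /lex4; lia.
  apply: (tc_for (T := 100 * B) (I := fun y s' => filled j l x y s')) => //.
  + by move=> s' fr'; rewrite /= fr'.1 // fr2'.1 // (env_size E0).
  + move=> y s3 yS fr3 hy F3.
    have fr3' : FR s0 s3 by apply: framed_step fr2' fr3 _.
    apply: tc_entry_filled => //.
    * by rewrite fr3.1 // fr2.1.
    * by rewrite fr3.1 // fr2.1.
    * by rewrite fr3.1.
  by rewrite (expnSr B 1) expn1 mulnA; apply: for_time => //; lia.
by rewrite (expnSr B 2) mulnA; apply: for_time => //; lia.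
Qed.

Lemma tc_init_weights :
  tc InitWeights s0 (132 * B ^ 5) (fun s' =>
    eq_weights S n (mem_entry B s') (mem_weight s0 n K J) /\
    forall j l, (j < n)%N -> (l < n)%N ->
      nmem s' 7 (j * B + l) = nmem s0 1 (j * n + l)).
Proof.
have nB := env_nB E0; have B0 : (0 < B)%N by lia.
have B3 : (0 < B ^ 3)%N by rewrite expn_gt0 B0.
have B4 : (0 < B ^ 4)%N by rewrite expn_gt0 B0.
apply: (tc_conseq (T := 132 * B ^ 5) (Q := fun s' =>
  framed (20 :: nwrites (For 21 (NAdd nE (NConst 1)) InitPair))
    (rwrites (For 21 (NAdd nE (NConst 1)) InitPair)) s0 s' /\
  (filled (n + 1) 0 0 0 s' /\ copied (n + 1) 0 s')));
  [|exact: leqnn|]; last first.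
  move=> s' _ [_ [F Cp]]; split=> [j l x y jn ln xS yS|j l jn ln].
    by apply: F => //; rewrite /lex4; lia.
  by apply: Cp => //; lia.
apply: (tc_for (T := 126 * B ^ 4)
  (I := fun j s' => filled j 0 0 0 s' /\ copied j 0 s')) => //.
- by move=> s' fr'; rewrite /= fr'.1 // (env_n E0).
- by split=> [j l x y jn ln xS yS|j l jn ln]; rewrite /lex4; lia.
- move=> j s1 jn fr1 hj I1.
  apply: (tc_conseq (T := 126 * B ^ 4) (Q := fun s' =>
    framed (21 :: nwrites InitPair) (rwrites InitPair) s1 s' /\
    (filled j (n + 1) 0 0 s' /\ copied j (n + 1) s'))); [|exact: leqnn|]; last first.
    move=> s' _ [_ [F Cp]]; split=> [j' l x y jn' ln xS yS L|j' l jn' ln L].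
      by apply: F => //; move: L; rewrite /lex4; lia.
    by apply: Cp => //; move: L; lia.
  apply: (tc_for (T := 120 * B ^ 3)
    (I := fun l s' => filled j l 0 0 s' /\ copied j l s')) => //.
  + by move=> s' fr'; rewrite /= fr'.1 // fr1.1 // (env_n E0).
  + move=> l s2 ln fr2 hl [F2 C2].
    apply: tc_init_pair => //; [|by rewrite fr2.1|lia|lia].
    by apply: framed_step (framed_step (framed_refl _ _ _) fr1 _) fr2 _.
  by rewrite (expnSr B 3) mulnA; apply: for_time; lia.
by rewrite (expnSr B 4) mulnA; apply: for_time; lia.
Qed.

End Init.

Lemma tc_scan s n B K J m : env s n B K J -> (m < n)%N ->
  nmem s 27 0 = m -> nmem s 28 0 = n -> nmem s 29 0 = n ->
  (size (lower_nbrs (mem_adj B s) m) <= 2)%N ->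
  tc ScanNeighbours s (9 * B) (fun s' =>
    nmem s' 28 0 = nth n (lower_nbrs (mem_adj B s) m) 0 /\
    nmem s' 29 0 = nth n (lower_nbrs (mem_adj B s) m) 1).
Proof.
move=> E mn hm ha hb sz; have nB := env_nB E.
pose ns i := [seq j <- iota 0 i | mem_adj B s j m].
apply: (tc_conseq (T := 9 * B)); [|exact: leqnn|].
  apply: (tc_for (N := m) (T := 3) (I := fun i s' =>
     nmem s' 28 0 = nth n (ns i) 0 /\ nmem s' 29 0 = nth n (ns i) 1)) => //.
  - by move=> s' fr; rewrite /= fr.1.
  - move=> i s' im fr hi [ai bi]; have E' := env_framed fr isT E.
    have nsS : ns i.+1 = ns i ++ (if mem_adj B s i m then [:: i] else [::]).
      by rewrite /ns -[i.+1]addn1 iotaD filter_cat /= add0n.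
    (* A third neighbour would overwrite variable 29; the degree bound excludes it. *)
    have sz' : (size (ns i.+1) <= 2)%N.
      apply: leq_trans sz; rewrite /lower_nbrs.
      have -> : iota 0 m = iota 0 i.+1 ++ iota i.+1 (m - i.+1).
        by rewrite -{1}(subnKC im) iotaD.
      by rewrite filter_cat size_cat leq_addr.
    have lt_ns x : x \in ns i -> (x < i)%N.
      by rewrite mem_filter mem_iota => /andP[].
    have tE : teval s' (NLe (NConst 1) (NGet 7 (pairE (nvar 20) (nvar 27)))) =
        mem_adj B s i m.
      change ((0 < nmem s' 7 (neval s' (pairE (nvar 20) (nvar 27))))%N =
        mem_adj B s i m).
      rewrite (neval_pairE E' (j := i) (l := m)) //; [|by rewrite /= fr.1|lia].
      by rewrite fr.1.
    apply: (tc_if (T := 2)) => //; rewrite tE => Aim; rewrite ?Aim in nsS.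
      rewrite nsS in sz'.
      apply: (tc_if (T := 1)) => //=; rewrite (env_n E') ai => h.
        apply: tc_nset => //=; rewrite /update /= hi bi nsS.
        case: (ns i) h lt_ns => [|x l] //= h lt_ns.
        by have := lt_ns x (mem_head _ _); lia.
      apply: tc_nset => //=; rewrite /update /= hi ai nsS.
      case: (ns i) h nsS sz' => [|x [|y l]] /=; rewrite ?leqnn //.
      by move=> _ _; rewrite size_cat /=; lia.
    by move: nsS; rewrite (negbTE Aim) cats0 => ->; apply: tc_skip.
  by nia.
by move=> s' _ [_].
Qed.

Lemma tc_update s n B K J m a b x y : env s n B K J ->
  nmem s 27 0 = m -> nmem s 28 0 = a -> nmem s 29 0 = b ->
  nmem s 22 0 = x -> nmem s 23 0 = y ->
  (m <= n)%N -> (a <= n)%N -> (b <= n)%N ->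
  (x < 2 ^ K.+1)%N -> (y < 2 ^ K.+1)%N ->
  tc UpdateWeight s (40 * B) (fun s' => forall e, cmem s' 4 5 e =
    if e == addr B a b x y then cmem s 4 5 e * \sum_(0 <= r < 2 ^ K.+1)
      (mem_entry B s m n r 0 * mem_entry B s a m x r * mem_entry B s b m y r)
    else cmem s 4 5 e).
Proof.
move=> E hm ha hb hx hy mn an bn xS yS; have KB := env_layerB E.
have SB := env_sizeB E.
pose X r := mem_entry B s m n r 0 * mem_entry B s a m x r * mem_entry B s b m y r.
apply: (tc_seq (T1 := 5) (T2 := 30 * B)); first by lia.
apply: tc_cset => // s1 fr1 acc1.
have E1 := env_framed fr1 isT E.
apply: (tc_seq (T1 := 14 * B) (T2 := 5)); first by lia.
apply: (tc_conseq (T := 14 * B)); [|exact: leqnn|].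
  apply: (tc_for (N := 2 ^ K.+1) (T := 5) (I := fun r s' =>
      cmem s' 6 7 0 = \sum_(0 <= i < r) X i)) => //.
  - by move=> s' fr; rewrite /= fr.1 // (env_size E1).
  - by rewrite big_geq // (acc1 0%N).
  - move=> r s2 rS fr2 hr acc2; have E2 := env_framed fr2 isT E1.
    apply: tc_cset => // s3 _ ->; rewrite eqxx.
    have A1 : neval s2 (addrE (nvar 27) nE (nvar 32) (NConst 0)) = addr B m n r 0.
      by apply: (neval_addrE E2) => //=; rewrite ?(env_n E2) ?fr2.1 ?fr1.1.
    have A2 : neval s2 (addrE (nvar 28) (nvar 27) (nvar 22) (nvar 32)) =
        addr B a m x r.
      by apply: (neval_addrE E2) => //=; rewrite ?fr2.1 ?fr1.1.
    have A3 : neval s2 (addrE (nvar 29) (nvar 27) (nvar 23) (nvar 32)) =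
        addr B b m y r.
      by apply: (neval_addrE E2) => //=; rewrite ?fr2.1 ?fr1.1.
    rewrite ceval_caddE !ceval_cmulE !ceval_cget acc2 big_nat_recr //.
    rewrite A1 A2 A3 /X /mem_entry.
    by rewrite /cmem !fr2.2 // !fr1.2.
  by apply: for_time => //; lia.
move=> s2 _ [fr2 acc2]; have E2 := env_framed fr2 isT E1.
apply: tc_cset => // s3 _ w3 e; rewrite w3.
have W2 e' : cmem s2 4 5 e' = cmem s 4 5 e' by rewrite /cmem !fr2.2 // !fr1.2.
have A : neval s2 (addrE (nvar 28) (nvar 29) (nvar 22) (nvar 23)) = addr B a b x y.
  by apply: (neval_addrE E2) => //=; rewrite ?fr2.1 ?fr1.1.
rewrite ceval_cmulE !ceval_cget acc2 A !W2.
by case: eqP => [->|].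
Qed.

Lemma tc_eliminate s n B K J i (o : 'I_(2 ^ K.+1)) : env s n B K J -> (i < n)%N ->
  nmem s 33 0 = i ->
  elim_inv (2 ^ K.+1) n (n - i) (mem_adj B s) (mem_entry B s) ->
  tc Eliminate s (100 * B ^ 3) (fun s' =>
    partition_fun o n (n - i.+1) (mem_entry B s') =
    partition_fun o n (n - i) (mem_entry B s) /\
    elim_inv (2 ^ K.+1) n (n - i.+1) (mem_adj B s') (mem_entry B s')).
Proof.
move=> E0 lt_in hi; pose m := (n - i.+1)%N.
have -> : (n - i = m.+1)%N by rewrite /m; lia.
rewrite -/m => Hinv; have mn : (m < n)%N by rewrite /m; lia.
have nB := env_nB E0; have SB := env_sizeB E0; have B0 : (0 < B)%N by lia.
have B2 : (0 < B ^ 2)%N by rewrite expn_gt0 B0.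
have B3 : (B <= B ^ 3)%N by rewrite -{1}[B]expn1 leq_pexp2l.
pose ns := lower_nbrs (mem_adj B s) m.
pose a := nth n ns 0; pose b := nth n ns 1.
have szns : (size ns <= 2)%N.
  by have [_ _ dg] := Hinv; rewrite /ns -count_linked_lower dg.
have nth_ns k : (nth n ns k < m)%N || (nth n ns k == n).
  case: (ltnP k (size ns)) => h; last by rewrite nth_default ?eqxx ?orbT.
  by have := mem_nth n h; rewrite mem_filter mem_iota => /andP[_ /andP[_ ->]].
have an : (a <= n)%N by have := nth_ns 0%N; rewrite -/a; lia.
have bn : (b <= n)%N by have := nth_ns 1%N; rewrite -/b; lia.
(* Since [a] and [b] differ from [m], the cells [(m, n)], [(a, m)] and [(b, m)] read by the update
   are never those it writes, [(a, b)]. This makes the update in place sound. *)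
have am : (a == m) = false by have := nth_ns 0%N; rewrite -/a; lia.
have bm : (b == m) = false by have := nth_ns 1%N; rewrite -/b; lia.
pose X x y := \sum_(0 <= r < 2 ^ K.+1)
  (mem_entry B s m n r 0 * mem_entry B s a m x r * mem_entry B s b m y r).
apply: (tc_seq (T1 := 1) (T2 := 90 * B ^ 3)); first by lia.
apply: tc_nset => //.
apply: (tc_seq (T1 := 1) (T2 := 85 * B ^ 3)); first by lia.
apply: tc_nset => //.
apply: (tc_seq (T1 := 1) (T2 := 80 * B ^ 3)); first by lia.
apply: tc_nset => //; set s1 := nset _ _ _ _.
have fr1 : framed [:: 27; 28; 29]%N [::] s s1.
  split=> // c e; rewrite !inE !negb_or => /and3P[/negbTE c1 /negbTE c2 /negbTE c3].
  by rewrite /s1 /= /update c1 c2 c3.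
have E1 := env_framed fr1 isT E0.
have s1m : nmem s1 27 0 = m.
  by rewrite /s1 /= /update /= (env_n E0) hi /m; lia.
have s1a : nmem s1 28 0 = n by rewrite /s1 /= /update /= (env_n E0).
have s1b : nmem s1 29 0 = n by rewrite /s1 /= /update /= (env_n E0).
apply: (tc_seq (T1 := 9 * B) (T2 := 65 * B ^ 3)); first by lia.
apply: tc_conseq (tc_scan E1 mn s1m s1a s1b szns) _ _ => // s2 fr2 [s2a s2b].
have E2 := env_framed fr2 isT E1.
have s2m : nmem s2 27 0 = m by rewrite fr2.1.
apply: (tc_seq (T1 := 1) (T2 := 60 * B ^ 3)); first by lia.
apply: tc_nset => //; rewrite (neval_pairE E2 (ej := nvar 28) (el := nvar 29) s2a s2b an).
set s3 := nset _ _ _ _.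
have fr3 : framed [:: 7]%N [::] s2 s3.
  by split=> // c e; rewrite !inE => /negbTE c1; rewrite /s3 /= /update c1.
have E3 := env_framed fr3 isT E2.
have W3 j l x y : mem_entry B s3 j l x y = mem_entry B s j l x y.
  by rewrite /mem_entry /cmem !fr3.2 // !fr2.2 // !fr1.2.
have hadj j l : (j < l < m)%N ->
    mem_adj B s3 j l = mem_adj B s j l || (j == a) && (l == b).
  move=> jl; rewrite /mem_adj /s3 /= /update eqxx /=.
  rewrite digits_inj; [|by move: jl mn nB; clear; lia|exact: leq_ltn_trans bn nB].
  case: ifP => _ /=; first by rewrite orbT.
  by rewrite orbF fr2.1 // fr1.1.
pose partial x0 y0 s' := forall j l x y, (j <= n)%N -> (l <= n)%N ->
  (x < 2 ^ K.+1)%N -> (y < 2 ^ K.+1)%N ->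
  mem_entry B s' j l x y = mem_entry B s j l x y *
    (if [&& j == a, l == b & (x < x0)%N || (x == x0) && (y < y0)%N]
     then X x y else 1).
have upd_step x y s' : framed (nwrites (For 22 sizeE (For 23 sizeE UpdateWeight)))
      (rwrites (For 22 sizeE (For 23 sizeE UpdateWeight))) s3 s' ->
    (x < 2 ^ K.+1)%N -> (y < 2 ^ K.+1)%N ->
    nmem s' 22 0 = x -> nmem s' 23 0 = y -> partial x y s' ->
    tc UpdateWeight s' (40 * B) (partial x y.+1).
  move=> fr xS yS hx hy P; have E := env_framed fr isT E3.
  have sm : nmem s' 27 0 = m by rewrite fr.1 // fr3.1.
  have sa : nmem s' 28 0 = a by rewrite fr.1 // fr3.1.
  have sb : nmem s' 29 0 = b by rewrite fr.1 // fr3.1.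
  apply: tc_conseq (tc_update E sm sa sb hx hy (ltnW mn) an bn xS yS) _ _ => //.
  move=> s'' _ U j l x' y' jn ln xS' yS'; rewrite {1}/mem_entry U.
  rewrite addr_eq; try lia.
  rewrite -/(mem_entry B s' j l x' y') P //.
  case: ifP => [/and4P[/eqP -> /eqP -> /eqP -> /eqP ->]|ne].
    rewrite !eqxx !ltnn ltnSn /= mulr1; congr (_ * _).
    apply: eq_big_nat => r /andP[_ rS].
    rewrite !P //; try lia.
    rewrite [m == a]eq_sym am [m == b]eq_sym bm /= !mulr1.
    by rewrite !andbF !mulr1.
  congr (_ * _); case: ifP; case: ifP => //; move: ne; clear; lia.
apply: (tc_conseq (T := 52 * B ^ 3) (Q := partial (2 ^ K.+1)%N 0%N)); last first.
- move=> s4 fr4 P4.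
  apply: elimination_step mn Hinv _ _.
    by move=> j l jl; rewrite /mem_adj fr4.1 // -hadj.
  move=> j l x y jn ln xS yS; rewrite P4 // xS /= andbT.
  by rewrite /X big_mkord.
- by lia.
apply: (tc_conseq (T := 52 * B ^ 3)); [|exact: leqnn|].
  apply: (tc_for (N := 2 ^ K.+1) (T := 46 * B ^ 2)
    (I := fun x s' => partial x 0%N s')) => //.
  - by move=> s' fr; rewrite /= fr.1 // (env_size E3).
  - by move=> j l x y *; rewrite W3 ltn0 andbF !andbF mulr1.
  - move=> x s4 xS fr4 hx P4.
    have E4 := env_framed fr4 isT E3.
    apply: (tc_conseq (T := 46 * B ^ 2)); [|exact: leqnn|].
      apply: (tc_for (N := 2 ^ K.+1) (T := 40 * B)
        (I := fun y s' => partial x y s')) => //.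
      + by move=> s' fr; rewrite /= fr.1 // (env_size E4).
      + move=> y s5 yS fr5 hy P5; apply: upd_step => //.
          by apply: framed_step (framed_step (framed_refl _ _ _) fr4 _) fr5 _.
        by rewrite fr5.1.
      by rewrite (expnSr B 1) expn1 mulnA; apply: for_time => //; lia.
    move=> s5 _ [_ P5] j l x' y' jn ln xS' yS'; rewrite P5 //.
    by congr (_ * _); case: ifP; case: ifP => //; lia.
  by rewrite (expnSr B 2) mulnA; apply: for_time => //; lia.
by move=> s4 _ [].
Qed.

Lemma tc_amplitude s n B K J (o : 'I_(2 ^ K.+1)) : env s n B K J ->
  elim_inv (2 ^ K.+1) n n (fun j l => (0 < nmem s 1 (j * n + l))%N)
    (mem_weight s n K J) ->
  tc Amplitude s (300 * B ^ 5) (fun s' =>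
    ceval s' amplitudeE = partition_fun o n n (mem_weight s n K J)).
Proof.
move=> E0 Hinv; have nB := env_nB E0; have B0 : (0 < B)%N by lia.
have B5 : (B ^ 4 <= B ^ 5)%N by rewrite leq_pexp2l.
have B3 : (0 < B ^ 3)%N by rewrite expn_gt0 B0.
have B4 : (0 < B ^ 4)%N by rewrite expn_gt0 B0.
apply: (tc_seq (T1 := 132 * B ^ 5) (T2 := 106 * B ^ 4)); first by lia.
apply: tc_conseq (tc_init_weights E0) _ _ => // s1 fr1 [W1 A1].
have E1 := env_framed fr1 isT E0.
apply: (tc_conseq (T := 106 * B ^ 4)); [|exact: leqnn|].
  apply: (tc_for (N := n) (T := 100 * B ^ 3) (I := fun i s' =>
      partition_fun o n (n - i) (mem_entry B s') =
      partition_fun o n n (mem_weight s n K J) /\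
      elim_inv (2 ^ K.+1) n (n - i) (mem_adj B s') (mem_entry B s'))) => //.
  - by move=> s' fr; rewrite /= fr.1 // (env_n E1).
  - rewrite subn0; split; first exact: partition_fun_eq W1.
    apply: elim_inv_eq Hinv => // [j l x y *|j l jl]; first by rewrite W1.
    by rewrite /mem_adj A1 //; lia.
  - move=> i s2 lt_in fr2 hi [P2 I2]; have E2 := env_framed fr2 isT E1.
    apply: tc_conseq (tc_eliminate o E2 lt_in hi I2) _ _ => // s3 _ [-> I3].
    by split.
  by rewrite (expnSr B 3) mulnA; apply: for_time; lia.
move=> s2 _ [fr2 [P2 _]]; have E2 := env_framed fr2 isT E1.
rewrite -P2 subnn partition_fun0 ceval_cget.
by rewrite (neval_addrE E2 (j := n) (l := n) (x := 0) (y := 0))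
  ?(env_n E2) // /= ?(env_n E2) // ?expn_gt0.
Qed.

End AmplitudeCorrect.

(** * Amplitudes as sums over paths *)

Lemma upd_eq (T : Type) (f : nat -> T) m r : upd f m r m = r.
Proof. by rewrite /upd eqxx. Qed.

Lemma upd_lt (T : Type) (f : nat -> T) m r i : (i < m)%N -> upd f m r i = f i.
Proof. by move=> im; rewrite /upd ltn_eqF. Qed.

Lemma bit_inj P x y : (x < 2 ^ P)%N -> (y < 2 ^ P)%N ->
  (forall k, (k < P)%N -> bit x k = bit y k) -> x = y.
Proof.
elim: P x y => [|P IH] x y; first by rewrite expn0 !ltnS !leqn0 => /eqP -> /eqP ->.
rewrite expnS => hx hy h.
have e0 : odd x = odd y by have := h 0%N isT.
have eh : x./2 = y./2.
  apply: IH => [||k kP]; [lia|lia|].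
  by have := h k.+1 kP; rewrite /bit !iterSr.
by rewrite -(odd_double_half x) -(odd_double_half y) e0 eh.
Qed.

Section Circuit.
Variables (C : comNzRingType) (n : nat).
Variables (mix : nat -> bool -> bool -> C) (g : nat -> nat -> nat -> bool -> bool -> C).
Implicit Types z x : bits n.

Definition qbit z (j : nat) : bool := ext_ffun false z j.

Definition phase (k : nat) x : C :=
  \prod_(0 <= j < n) g k j j (qbit x j) (qbit x j) *
  \prod_(0 <= l < n) \prod_(0 <= j < l) g k j l (qbit x j) (qbit x l).

(* Unnormalised amplitude of z after K layers. *)
Fixpoint psi (K : nat) z : C :=
  if K is K'.+1 then
    \sum_x phase K' x * psi K' x * \prod_(0 <= j < n) mix K' (qbit x j) (qbit z j)
  else 1.

(* Amplitude of z after K layers, the phase gates of layer K and the mixing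
   gates of layer K on the first J qubits. *)
Definition phi (K J : nat) z : C :=
  \sum_x phase K x * psi K x * \prod_(0 <= j < n)
    (if (j < J)%N then mix K (qbit x j) (qbit z j) else (qbit x j == qbit z j)%:R).

Lemma qbitE z (j : 'I_n) : qbit z j = z j.
Proof. exact: ext_ffunE. Qed.

Lemma psiS K z : psi K.+1 z =
  \sum_x phase K x * psi K x * \prod_(0 <= j < n) mix K (qbit x j) (qbit z j).
Proof. by []. Qed.

Lemma phi_full K z : phi K n z = psi K.+1 z.
Proof.
apply: eq_bigr => x _; congr (_ * _); by apply: eq_big_nat => j /andP[_ ->].
Qed.

Lemma phi0 K z : phi K 0 z = phase K z * psi K z.
Proof.
rewrite /phi (bigD1 z) //= big1 ?mulr1 => [|j _]; last by rewrite eqxx.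
rewrite big1 ?addr0 // => x /eqP nxz.
suff [j nj] : exists j : 'I_n, x j != z j.
  rewrite big_mkord (bigD1 j) //= !qbitE (negbTE nj) mul0r mulr0 //.
apply/existsP; apply: contra_notT nxz; rewrite negb_exists => /forallP h.
by apply/ffunP => j; apply/eqP; have := h j; rewrite negbK.
Qed.

(** Before its mixing gate, qubit [j] carries the factor [x j == z j], so [setb z j b] selects the
    paths with [x j = b]. The factors of the other qubits agree on both sides. *)
Lemma phiS K (j : 'I_n) z :
  phi K j.+1 z = mix K true (z j) * phi K j (setb z j true) +
                 mix K false (z j) * phi K j (setb z j false).
Proof.
rewrite /phi !big_distrr -big_split /=; apply: eq_bigr => x _.
have splitE (F : nat -> C) :
    \prod_(0 <= i < n) F i = F j * \prod_(i < n | i != j) F i.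
  by rewrite big_mkord (bigD1 j).
rewrite !splitE !qbitE ltnSn ltnn !ffunE eqxx.
set P := \prod_(i < n | _) _.
have prodE b : \prod_(i < n | i != j) (if (i < j)%N then
    mix K (qbit x i) (qbit (setb z j b) i)
    else (qbit x i == qbit (setb z j b) i)%:R) = P.
  apply: eq_bigr => i ij; rewrite !qbitE ffunE (negbTE ij) ltnS (leq_eqVlt i j).
  suff -> : (i == j :> nat) = false by [].
  by apply: contraNF ij => /eqP/val_inj ->.
by rewrite !prodE; case: (x j) => /=; ring.
Qed.

(** Unrolls the recursion of [psi]. The last layer mixes into [z] itself, which is the reason for
    the test [k.+1 < K]. *)
Lemma psi_path x0 K z :
  psi K z = \sum_(X : {ffun 'I_K -> bits n}) \prod_(0 <= k < K)
    (phase k (ext_ffun x0 X k) * \prod_(0 <= j < n) mix k (qbit (ext_ffun x0 X k) j)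
       (qbit (if (k.+1 < K)%N then ext_ffun x0 X k.+1 else z) j)).
Proof.
elim: K z => [|K IH] z.
  rewrite /= (eq_bigr (fun=> 1)) => [|X _]; last by rewrite big_geq.
  by rewrite sumr_const card_ffun !card_ord expn0.
pose F z K (X : nat -> bits n) := \prod_(0 <= k < K)
    (phase k (X k) * \prod_(0 <= j < n) mix k (qbit (X k) j)
       (qbit (if (k.+1 < K)%N then X k.+1 else z) j)).
rewrite -[RHS]/(\sum_(X : {ffun 'I_K.+1 -> bits n}) F z K.+1 (ext_ffun x0 X)).
rewrite sum_ffunS exchange_big /=; apply: eq_bigr => x _.
rewrite IH big_distrr big_distrl /=; apply: eq_bigr => X _.
rewrite {1}/F big_nat_recr //= ltnn !upd_eq.
rewrite mulrAC [LHS]mulrC; congr (_ * _).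
apply: eq_big_nat => k /andP[_ kK]; rewrite !(upd_lt _ _ kK).
congr (_ * _); apply: eq_bigr => j _; congr (mix _ _ (qbit _ _)).
by rewrite ltnS kK /upd; case: (ltngtP k.+1 K) => // h; exfalso; lia.
Qed.

Lemma phi_path x0 K J z :
  phi K J z = \sum_(X : {ffun 'I_K.+1 -> bits n}) \prod_(0 <= k < K.+1)
    (phase k (ext_ffun x0 X k) * \prod_(0 <= j < n)
      (if (k < K)%N || (j < J)%N then mix k (qbit (ext_ffun x0 X k) j)
         (qbit (if (k < K)%N then ext_ffun x0 X k.+1 else z) j)
       else (qbit (ext_ffun x0 X k) j == qbit z j)%:R)).
Proof.
pose F (X : nat -> bits n) := \prod_(0 <= k < K.+1)
    (phase k (X k) * \prod_(0 <= j < n)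
      (if (k < K)%N || (j < J)%N then mix k (qbit (X k) j)
         (qbit (if (k < K)%N then X k.+1 else z) j)
       else (qbit (X k) j == qbit z j)%:R)).
rewrite -[RHS]/(\sum_(X : {ffun 'I_K.+1 -> bits n}) F (ext_ffun x0 X)).
rewrite sum_ffunS exchange_big /=; apply: eq_bigr => x _.
rewrite (psi_path x0) big_distrr big_distrl /=; apply: eq_bigr => X _.
rewrite {1}/F big_nat_recr //= ltnn !upd_eq /=.
rewrite mulrAC [LHS]mulrC; congr (_ * (_ * _)).
apply: eq_big_nat => k /andP[_ kK]; rewrite !(upd_lt _ _ kK).
congr (_ * _); apply: eq_bigr => j _; rewrite kK /=.
congr (mix _ _ (qbit _ _)).
by rewrite /upd; case: (ltngtP k.+1 K) => // h; exfalso; lia.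
Qed.

(** One table of bits is read by layers as [K + 1] strings and by qubits as [n] numbers with [K + 1]
    binary digits. The map [h] transposes it, and the products over layers and qubits are exchanged
    accordingly. *)
Lemma partition_fun_phi K (J : nat) z (o : 'I_(2 ^ K.+1)) (W : nat -> nat -> nat -> nat -> C) :
  W n n 0%N 0%N = 1 ->
  (forall j (x : nat), (j < n)%N -> (x < 2 ^ K.+1)%N -> W j n x 0%N = \prod_(0 <= k < K.+1)
     (g k j j (bit x k) (bit x k) *
      (if (k < K)%N || (j < J)%N then
         mix k (bit x k) (if (k < K)%N then bit x k.+1 else qbit z j)
       else (bit x k == qbit z j)%:R))) ->
  (forall j l (x y : nat), (j < l < n)%N -> (x < 2 ^ K.+1)%N -> (y < 2 ^ K.+1)%N ->
     W j l x y = \prod_(0 <= k < K.+1) g k j l (bit x k) (bit y k)) ->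
  partition_fun o n n W = phi K J z.
Proof.
move=> Wnn Wu Wp; rewrite (phi_path z).
pose h (f : {ffun 'I_n -> 'I_(2 ^ K.+1)}) : {ffun 'I_K.+1 -> bits n} :=
  [ffun k : 'I_K.+1 => [ffun j => bit (f j) k]].
have h_inj : injective h.
  move=> f f' e; apply/ffunP => j; apply: val_inj.
  apply: (@bit_inj K.+1); [exact: ltn_ord|exact: ltn_ord|move=> k kK].
  have := congr1 (fun X : {ffun 'I_K.+1 -> bits n} => X (Ordinal kK) j) e.
  by rewrite !ffunE.
(* Both types have [2 ^ (n * (K + 1))] elements, so injectivity suffices and no inverse is written
   down. *)
have h_bij : bijective h.
  apply: inj_card_bij => //.
  by rewrite !card_ffun !card_ord card_bool -!expnM mulnC.
rewrite [RHS](reindex h) /=; last exact: onW_bij.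
apply: eq_bigr => f _; set sg := ext_ffun o f.
have sgS j : (sg j < 2 ^ K.+1)%N by apply: ltn_ord.
have hE k j : (k < K.+1)%N -> (j < n)%N ->
    qbit (ext_ffun z (h f) k) j = bit (sg j) k.
  move=> kK jn; rewrite -[k]/(val (Ordinal kK)) -[j]/(val (Ordinal jn)).
  by rewrite ext_ffunE qbitE !ffunE /sg ext_ffunE.
rewrite /weight Wnn mul1r.
have -> : \prod_(0 <= j < n) W j n (sg j) 0%N =
    \prod_(0 <= k < K.+1) \prod_(0 <= j < n)
      (g k j j (bit (sg j) k) (bit (sg j) k) *
      (if (k < K)%N || (j < J)%N then
         mix k (bit (sg j) k) (if (k < K)%N then bit (sg j) k.+1 else qbit z j)
       else (bit (sg j) k == qbit z j)%:R)).
  rewrite [RHS]exchange_big_nat /=; apply: eq_big_nat => j /andP[_ jn].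
  by rewrite Wu.
have -> : \prod_(0 <= l < n) \prod_(0 <= j < l) W j l (sg j) (sg l) =
    \prod_(0 <= k < K.+1) \prod_(0 <= l < n) \prod_(0 <= j < l)
      g k j l (bit (sg j) k) (bit (sg l) k).
  rewrite [RHS]exchange_big_nat /=; apply: eq_big_nat => l /andP[_ ln].
  rewrite [RHS]exchange_big_nat /=; apply: eq_big_nat => j /andP[_ jl].
  by rewrite Wp // jl.
rewrite -big_split /=; apply: eq_big_nat => k /andP[_ kK].
rewrite big_split /= mulrAC /phase; congr (_ * _ * _).
- by apply: eq_big_nat => j /andP[_ jn]; rewrite !hE.
- apply: eq_big_nat => l /andP[_ ln]; apply: eq_big_nat => j /andP[_ jl].
  by rewrite !hE //; apply: ltn_trans ln.
apply: eq_big_nat => j /andP[_ jn]; rewrite !hE //.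
by case: ifP => // _; case: ltnP => // kK'; rewrite hE.
Qed.

End Circuit.

(** * Exponentials of the Hamiltonians *)

Section ComplexExponential.
Local Open Scope complex_scope.
Variable R : realType.
Implicit Types (a b t : R).

Definition cis t : R[i] := cos t +i* sin t.

Lemma cis0 : cis 0 = 1.
Proof. by rewrite /cis cos0 sin0. Qed.

Lemma cisD a b : cis (a + b) = cis a * cis b.
Proof. by rewrite /cis cosD sinD; congr (_ +i* _); rewrite addrC [cos a * _]mulrC. Qed.

Lemma cis_sum (I : finType) (P : pred I) (F : I -> R) :
  cis (\sum_(i | P i) F i) = \prod_(i | P i) cis (F i).
Proof. exact: (big_morph cis cisD cis0). Qed.

(** Free of the square root in [normc], so that its identities are polynomial and fall to [ring]. *)
Definition normsq (z : R[i]) : R := let: a +i* b := z in a ^+ 2 + b ^+ 2.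

Lemma normsq_ge0 z : 0 <= normsq z.
Proof. by case: z => a b; rewrite addr_ge0 ?sqr_ge0. Qed.

Lemma normcX2 z : ComplexField.Normc.normc z ^+ 2 = normsq z.
Proof. by case: z => a b; rewrite /= sqr_sqrtr // (normsq_ge0 (a +i* b)). Qed.

Lemma normsqM z w : normsq (z * w) = normsq z * normsq w.
Proof. by case: z w => [a b] [c d]; rewrite /normsq /=; ring. Qed.

Lemma normsq_cis t : normsq (cis t) = 1.
Proof. exact: cos2Dsin2. Qed.

Lemma cvg_complex (u v : nat -> R) a b :
  u @ \oo --> a -> v @ \oo --> b ->
  (fun m => u m +i* v m : R[i]^o) @ \oo --> (a +i* b : R[i]^o).
Proof.
(* A positive complex number is real, so the imaginary part [f] of the tolerance is 0. *)
move=> ua vb; apply/cvgrPdist_lt => -[e f]; rewrite ltcE /= => /andP[/eqP -> e0].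
have e2 : 0 < e / 2 by rewrite divr_gt0.
near=> m.
have h1 : `|a - u m| < e / 2.
  by near: m; move/cvgrPdist_lt: ua; apply.
have h2 : `|b - v m| < e / 2.
  by near: m; move/cvgrPdist_lt: vb; apply.
have -> : (a +i* b : R[i]) - (u m +i* v m) = (a - u m)%:C + 'i * (b - v m)%:C.
  by simpc.
apply: le_lt_trans (ler_normD _ _) _.
rewrite normrM !normc_def /= !expr0n /= !(addr0, add0r) expr1n sqrtr1 mul1r.
rewrite !sqrtr_sqr -rmorphD /= ltcR.
by rewrite [e]splitr ltrD.
Unshelve. all: by end_near.
Qed.

Lemma exp_coeff_cis t k :
  (k`!%:R)^-1 * ('i * t%:C) ^+ k = cos_coeff t k +i* sin_coeff t k.
Proof.
have fE : (k`!%:R : R[i])^-1 = (k`!%:R^-1)%:C by rewrite fmorphV rmorph_nat.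
rewrite fE exprMn -rmorphXn /= mulrCA -rmorphM /=.
rewrite /cos_coeff /sin_coeff /=.
(* Splits the powers of ['i] by parity, in the very form used by the Taylor coefficients of cosine
   and sine. *)
have -> : 'i ^+ k = ((~~ odd k)%:R * (-1) ^+ k./2) +i*
    ((odd k)%:R * (-1) ^+ k.-1./2) :> R[i].
  have sgE m : (-1) ^+ m = ((-1) ^+ m)%:C :> R[i] by rewrite rmorphXn rmorphN1.
  rewrite -{1}(odd_double_half k); case ok: (odd k) => /=.
    have -> : k.-1./2 = k./2 by have := odd_double_half k; rewrite ok; lia.
    rewrite add1n exprS -mul2n exprM sqr_i sgE.
    by apply/eqP; rewrite eq_complex /=; apply/andP; split; apply/eqP; ring.
  rewrite add0n -mul2n exprM sqr_i sgE.
  by apply/eqP; rewrite eq_complex /=; apply/andP; split; apply/eqP; ring.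
apply/eqP; rewrite eq_complex /=; apply/andP; split; apply/eqP;
  rewrite -?exprnP; ring.
Qed.

Lemma sum_complex (I : Type) (r : seq I) (F G : I -> R) :
  \sum_(i <- r) (F i +i* G i) = (\sum_(i <- r) F i) +i* (\sum_(i <- r) G i).
Proof. by elim: r => [|i r IH]; rewrite ?big_nil // !big_cons IH. Qed.

(** Entrywise spectral calculus: knowing an entry of every power as a combination of powers of
    ['i * t w] is enough to sum the exponential series, without matrix norms or a change of
    basis. *)
Lemma expmx_entry N (A : 'M[R[i]]_N) x y (I : finType) (c : I -> R[i]) (t : I -> R) :
  (forall k, (A ^+ k) x y = \sum_w c w * ('i * (t w)%:C) ^+ k) ->
  expmx A x y = \sum_w c w * cis (t w).
Proof.
move=> hA; rewrite mxE.
apply: (@cvg_lim (R[i]^o)); first exact: norm_hausdorff.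
have -> : series (fun k : nat => (k`!%:R)^-1 * (A ^+ k) x y : R[i]^o) =
    (fun m => \sum_w c w * (series (cos_coeff (t w)) m +i* series (sin_coeff (t w)) m) : R[i]^o).
  apply/funext => m; rewrite /series /=.
  under eq_bigr do rewrite hA big_distrr /=.
  rewrite exchange_big /=; apply: eq_bigr => w _.
  rewrite -sum_complex big_distrr /=; apply: eq_bigr => k _.
  by rewrite -exp_coeff_cis mulrCA.
apply: cvg_big => [|w _]; first exact: add_continuous.
apply: cvgMl_tmp; apply: cvg_complex.
  by rewrite cos.unlock; apply: is_cvg_series_cos_coeff.
by rewrite sin.unlock; apply: is_cvg_series_sin_coeff.
Qed.

End ComplexExponential.

(** * Matrix entries of the exponentials of the mixer and of the cost *)

Section Operators.
Local Open Scope complex_scope.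
Variables (R : realType) (n : nat).
Local Notation C := R[i].

Definition bsign (b : bool) : R := if b then -1 else 1.

Lemma sum_bits_prod (F : 'I_n -> bool -> C) :
  \sum_(w : bits n) \prod_j F j (w j) = \prod_j (F j true + F j false).
Proof.
by rewrite -bigA_distr_bigA; apply: eq_bigr => j _; rewrite big_bool.
Qed.

Lemma bsign_flip (w x : bits n) j :
  \prod_i bsign (w i && flip j x i) = bsign (w j) * \prod_i bsign (w i && x i).
Proof.
rewrite (bigD1 j) //= [in RHS](bigD1 j) //= mulrA; congr (_ * _).
  by rewrite ffunE eqxx /bsign; case: (w j); case: (x j) => /=; ring.
by apply: eq_bigr => i /negbTE ij; rewrite ffunE ij.
Qed.

Lemma mulmx_entry N (A B : 'M[C]_N) x y : (A * B) x y = \sum_u A x u * B u y.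
Proof. by rewrite -[A * B]/(A *m B) mxE. Qed.

(* The characters w |-> (-1) ^ (w . x) diagonalise every X_j, with eigenvalue
   (-1) ^ (w_j). *)
Lemma mixer_pow (b : R) k x y :
  (((0 -i* b) *: mixer R n) ^+ k) x y = \sum_(w : bits n)
    ((2^-1) ^+ n * \prod_j bsign (w j && enum_val x j) *
      \prod_j bsign (w j && enum_val y j))%:C *
    ('i * (\sum_j - b * bsign (w j))%:C) ^+ k.
Proof.
elim: k x => [|k IH] x.
  rewrite expr0 mxE.
  under eq_bigr do rewrite expr0 mulr1.
  rewrite (eq_bigr (fun w : bits n => \prod_j
    (2^-1 * bsign (w j && enum_val x j) * bsign (w j && enum_val y j))%:C)); last first.
    move=> w _; rewrite -rmorph_prod !big_split /=.
    by rewrite prodr_const card_ord.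
  rewrite (sum_bits_prod (fun j c =>
    (2^-1 * bsign (c && enum_val x j) * bsign (c && enum_val y j))%:C)).
  (* Orthogonality of the two characters of a single bit; their product over the qubits gives the
     identity matrix, the case [k = 0]. *)
  have half j : (2^-1 * bsign (true && enum_val x j) * bsign (true && enum_val y j))%:C
      + (2^-1 * bsign (false && enum_val x j) * bsign (false && enum_val y j))%:C =
      ((enum_val x j == enum_val y j)%:R : C).
    rewrite /bsign /= -rmorphD /=.
    by case: (enum_val x j); case: (enum_val y j); rewrite /= -(rmorph_nat (real_complex R));
      congr (_ %:C); field.
  under eq_bigr do rewrite half.
  case: eqP => [->|nxy]; first by rewrite big1 // => j _; rewrite eqxx.
  case: (pickP (fun j => enum_val x j != enum_val y j)) => [j nj|all_eq].
    by rewrite (bigD1 j) //= (negbTE nj) mul0r.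
  case: nxy; apply: enum_val_inj; apply/ffunP => j.
  by apply/eqP; have /negbFE := all_eq j.
rewrite exprS mulmx_entry.
(* Row [x] of the mixer is supported on the strings [flip j x], so the matrix product becomes a sum
   over qubits. *)
transitivity (\sum_(j < n) (0 -i* b) *
  (((0 -i* b) *: mixer R n) ^+ k) (enum_rank (flip j (enum_val x))) y).
  transitivity (\sum_u \sum_(j < n) (if u == enum_rank (flip j (enum_val x)) then
      (0 -i* b) * (((0 -i* b) *: mixer R n) ^+ k) u y else 0)).
    apply: eq_bigr => u _; rewrite {1}mxE summxE big_distrr big_distrl /=.
    apply: eq_bigr => j _; rewrite mxE.
    have -> : (u == enum_rank (flip j (enum_val x))) = (enum_val x == flip j (enum_val u)).
      apply/eqP/eqP => [->|->]; first by rewrite enum_rankK flipK.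
      by rewrite flipK enum_valK.
    by case: eqP => _; rewrite ?mulr1 ?mulr0 ?mul0r.
  rewrite exchange_big /=; apply: eq_bigr => j _.
  by rewrite -big_mkcond big_pred1_eq.
under eq_bigr do rewrite IH big_distrr /=.
rewrite exchange_big /=; apply: eq_bigr => w _.
rewrite exprS [RHS]mulrA [_ * ('i * _)]mulrC -[RHS]mulrA.
rewrite rmorph_sum !big_distrr big_distrl /=; apply: eq_bigr => j _.
rewrite enum_rankK bsign_flip.
set X := _ ^+ k; set P := \prod_j _; set P' := \prod_j _.
rewrite !rmorphM /= rmorphN.
have -> : 0 -i* b = - ('i * b%:C) by simpc.
ring.
Qed.

(** The spectral sum over [w] factors into one-qubit sums, half of [cis (- b)] plus or minus
    [cis b]: cosine when the two bits agree, [-i] times sine when they differ. *)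
Lemma mixer_exp (b : R) x y :
  expmx ((0 -i* b) *: mixer R n) x y =
  \prod_j (if enum_val x j == enum_val y j then (cos b)%:C else 0 -i* sin b).
Proof.
rewrite (expmx_entry (mixer_pow b ^~ x ^~ y)).
rewrite (eq_bigr (fun w : bits n => \prod_j
  ((2^-1 * bsign (w j && enum_val x j) * bsign (w j && enum_val y j))%:C *
   cis (- b * bsign (w j))))); last first.
  move=> w _; rewrite cis_sum big_split /=; congr (_ * _).
  by rewrite -rmorph_prod !big_split /= prodr_const card_ord.
rewrite (sum_bits_prod (fun j c =>
  (2^-1 * bsign (c && enum_val x j) * bsign (c && enum_val y j))%:C *
   cis (- b * bsign c))).
apply: eq_bigr => j _; rewrite /bsign /cis /= mulrN mulr1 opprK mulr1 cosN sinN.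
by case: (enum_val x j); case: (enum_val y j) => /=; apply/eqP;
  rewrite eq_complex /=; apply/andP; split; apply/eqP; field.
Qed.

Lemma cost_exp p (Q : qaoa R n p) (c : R) x y :
  expmx ((0 -i* c) *: cost_op Q) x y =
  (x == y)%:R * cis (- c * cost Q (enum_val x)).
Proof.
rewrite (expmx_entry (I := 'I_1) (c := fun=> (x == y)%:R)
  (t := fun=> - c * cost Q (enum_val x))) ?big_ord1 // => k.
rewrite big_ord1; elim: k x => [|k IH] x; first by rewrite !expr0 mxE mulr1.
rewrite exprS mulmx_entry (bigD1 x) //= big1 ?addr0 => [|u ux]; last first.
  by rewrite !mxE eq_sym (negbTE ux) mulr0n mulr0 mul0r.
rewrite IH !mxE eqxx mulr1n exprS.
have -> : 'i * (- c * cost Q (enum_val x))%:C =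
    (0 -i* c) * (cost Q (enum_val x))%:C :> C by simpc; congr (_ +i* _); ring.
by rewrite mulrCA.
Qed.

End Operators.

(** * Splitting the cost function by the supports of its terms *)

Section Cost.
Local Open Scope complex_scope.
Local Open Scope set_scope.
Variables (R : realType) (n p : nat) (Q : qaoa R n p).

(** [x] is moved to [y] one differing bit at a time. Each such bit lies off the support, so its flip
    leaves [f] unchanged at every string met on the way. *)
Lemma eq_on_support (f : bits n -> R) (x y : bits n) :
  (forall j : 'I_n, j \in Defs.support f -> x j = y j) -> f x = f y.
Proof.
have [m] := ubnP #|[set j | x j != y j]|; elim: m x => [//|m IH] x.
move=> le_m agr; case: (set_0Vmem [set j | x j != y j]) => [e0|[j]].
  congr f; apply/ffunP => j.
  apply/eqP/negbNE/negP => nj.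
  by have : j \in [set j | x j != y j]; [rewrite inE|rewrite e0 inE].
rewrite inE => nj.
have jS : j \notin Defs.support f by apply: contraNN nj => /agr ->.
have fl : f (flip j x) = f x.
  by apply/eqP; move: jS; rewrite inE negb_exists => /forallP/(_ x); rewrite negbK.
rewrite -fl; apply: IH => [|i iS].
  rewrite -ltnS; apply: leq_trans le_m; apply: proper_card.
  apply/properP; split.
    apply/fintype.subsetP => i; rewrite !inE ffunE; case: (eqVneq i j) => [->|//].
    by move: nj; case: (x j); case: (y j).
  exists j; rewrite !inE // ffunE eqxx.
  by move: nj; case: (x j); case: (y j).
rewrite ffunE; case: eqP iS => [->|_ iS]; last exact: agr.
by rewrite (negbTE jS).
Qed.

Definition constant_cost : R :=
  \sum_(i | Defs.support (term (q := Q) i) == finset.set0) term (q := Q) i [ffun=> false].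

(** A support has at most two elements, so each term is counted exactly once: in the constant if it
    is empty, at [j = l] if it is a singleton, and otherwise at the one increasing pair that lists
    it. *)
Lemma cost_split (x : bits n) :
  cost Q x = constant_cost + (\sum_j merged_cost Q j j (x j) (x j) +
    \sum_(l < n) \sum_(j < n | (j < l)%N) merged_cost Q j l (x j) (x l)).
Proof.
pose S i := Defs.support (term (q := Q) i).
(* [merged_cost] evaluates a term at a string that is zero off [j] and [l]; the term cannot tell it
   from [x]. *)
have termE i (j l : 'I_n) : S i == [set j; l] ->
    term (q := Q) i [ffun k => if k == j then x j else (k == l) && x l] = term (q := Q) i x.
  move=> /eqP E; apply: eq_on_support => k; rewrite -/(S i) E !inE ffunE.
  by case: (eqVneq k j) => [-> //|_ /= /eqP ->]; rewrite eqxx.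
have m_jl j l : merged_cost Q j l (x j) (x l) =
    \sum_i (if S i == [set j; l] then term (q := Q) i x else 0).
  by rewrite /merged_cost big_mkcond; apply: eq_bigr => i _; case: ifP => // /termE.
have c0 : constant_cost = \sum_i (if S i == finset.set0 then term (q := Q) i x else 0).
  rewrite /constant_cost big_mkcond; apply: eq_bigr => i _.
  rewrite -/(S i); case: eqP => // E; apply: eq_on_support => k.
  by rewrite -/(S i) E inE.
have c1 : \sum_j merged_cost Q j j (x j) (x j) =
    \sum_i \sum_j (if S i == [set j; j] then term (q := Q) i x else 0).
  by rewrite exchange_big /=; apply: eq_bigr => j _; rewrite m_jl.
have c2 : \sum_(l < n) \sum_(j < n | (j < l)%N) merged_cost Q j l (x j) (x l) =
    \sum_i \sum_(l < n) \sum_(j < n | (j < l)%N)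
      (if S i == [set j; l] then term (q := Q) i x else 0).
  rewrite [RHS]exchange_big /=; apply: eq_bigr => l _.
  by rewrite [RHS]exchange_big /=; apply: eq_bigr => j _; rewrite m_jl.
rewrite c0 c1 c2 -!big_split /=.
apply: eq_bigr => i _; move: (term_local (q := Q) i); rewrite -/(S i).
have noPair (A : {set 'I_n}) : (#|A| < 2)%N ->
    \sum_(l < n) \sum_(j < n | (j < l)%N)
      (if A == [set j; l] then term (q := Q) i x else 0) = 0.
  move=> cA; apply: big1 => l _; apply: big1 => j jl; case: eqP => // E.
  by move: cA; rewrite E cards2; case: eqP jl => [->|//]; rewrite ltnn.
have noSingle (A : {set 'I_n}) : #|A| != 1%N ->
    \sum_j (if A == [set j; j] then term (q := Q) i x else 0) = 0.
  move=> cA; apply: big1 => j _; case: eqP => // E.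
  by move: cA; rewrite E finset.setUid cards1.
case cS: #|S i| => [|[|[|//]]] _.
- move/eqP: cS; rewrite cards_eq0 => /eqP ->.
  by rewrite eqxx noSingle ?cards0 // noPair ?cards0 // !addr0.
- move/eqP: cS => /cards1P[a ->].
  rewrite noPair ?cards1 // -cards_eq0 cards1 add0r addr0 (bigD1 a) //= finset.setUid eqxx.
  rewrite big1 ?addr0 // => j ja; rewrite finset.setUid; case: eqP => // /finset.set1_inj E.
  by rewrite E eqxx in ja.
move/eqP: cS => /cards2P[a [b [nab ->]]].
rewrite noSingle; last by rewrite cards2 nab.
rewrite -cards_eq0 cards2 nab /= !add0r.
wlog ab : a b nab / (a < b)%N => [hw|].
  have : (a != b :> nat) by apply: contraNN nab => /eqP/val_inj ->.
  rewrite neq_ltn => /orP[ab|ba]; first exact: hw.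
  by rewrite (finset.setUC [set a]); apply: hw ba; rewrite eq_sym.
rewrite (bigD1 b) //= (bigD1 a) //= eqxx !big1 ?addr0 //.
- move=> l lb; apply: big1 => j jl; case: eqP => // E.
  have : b \in [set j; l] by rewrite -E !inE eqxx orbT.
  rewrite !inE eq_sym [b == l]eq_sym (negbTE lb) orbF => /eqP jb.
  have : a \in [set j; l] by rewrite -E !inE eqxx.
  by rewrite !inE => /orP[] /eqP al; move: ab jl nab; rewrite al ?jb ?eqxx //; lia.
move=> j /andP[jb ja]; case: eqP => // E.
have : a \in [set j; b] by rewrite -E !inE eqxx.
by rewrite !inE [a == j]eq_sym (negbTE ja) (negbTE nab).
Qed.

End Cost.

Lemma table_at (I : finType) (V : Type) (x0 : V) (adr : I -> nat) (v : I -> V) i :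
  injective adr -> table x0 adr v (adr i) = v i.
Proof.
move=> inj; rewrite /table; case: pickP => [j /eqP/inj -> //|/(_ i)].
by rewrite eqxx.
Qed.

Lemma gate_addr_inj n p : injective (@gate_addr n p).
Proof.
move=> [[[[k j] l] a] b] [[[[k' j'] l'] a'] b'] /= /eqP.
rewrite digits_inj; [|by case: a; case: b|by case: a'; case: b'].
rewrite !digits_inj ?ltn_ord //; [|by case: b|by case: b'].
move=> /andP[/andP[/andP[/eqP/val_inj -> /eqP/val_inj ->] /eqP/val_inj ->]].
by case: a; case: a' => //; case: b; case: b'.
Qed.

(** * Identification of the QAOA amplitudes with the sums over paths *)

Section Circuits.
Local Open Scope complex_scope.
Variable R : realType.
Implicit Type s : store R.

Definition cmix s (k : nat) (a b : bool) : R[i] := mem_mix s k a b.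

Definition cgate s (n k j l : nat) (a b : bool) : R[i] := mem_gate s n k j l a b.

Lemma normsq_unitary (c s : R) (u v : R[i]) : c ^+ 2 + s ^+ 2 = 1 ->
  normsq ((c +i* 0) * u + (0 +i* s) * v) + normsq ((0 +i* s) * u + (c +i* 0) * v) =
  normsq u + normsq v.
Proof.
case: u v => [a b] [d e] h; rewrite /normsq /=.
transitivity ((c ^+ 2 + s ^+ 2) * (a ^+ 2 + b ^+ 2 + (d ^+ 2 + e ^+ 2))); first by ring.
by rewrite h mul1r.
Qed.

Section Input.
Variables (n p : nat) (Q : qaoa R n p).
Local Notation s0 := (input_store Q).

Lemma mem_gate_input (k : 'I_p) (j l : 'I_n) (a b : bool) :
  mem_gate s0 n k j l a b = cis (- merged_angle Q (k, j, l, a, b)).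
Proof.
have inj := @gate_addr_inj n p.
rewrite /mem_gate /cmem /cis cosN sinN /=.
by rewrite -[gate_cell _ _ _ _ _ _]/(gate_addr (k, j, l, a, b)) !table_at.
Qed.

Lemma cmix_input (k : 'I_p) (a b : bool) :
  cmix s0 k a b = if a == b then (cos (beta Q k))%:C else 0 -i* sin (beta Q k).
Proof.
rewrite /cmix /mem_mix /= !table_at; try exact: val_inj.
by case: a; case: b.
Qed.

Lemma phase_input (k : 'I_p) (x : bits n) :
  cis (- gamma Q k * cost Q x) =
  cis (- gamma Q k * constant_cost Q) * phase (cgate s0 n) k x.
Proof.
rewrite cost_split !mulrDr !cisD; congr (_ * (_ * _)).
  rewrite mulr_sumr cis_sum big_mkord; apply: eq_bigr => j _.
  by rewrite /cgate qbitE mem_gate_input /merged_angle mulNr.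
rewrite mulr_sumr cis_sum big_mkord; apply: eq_bigr => l _.
rewrite mulr_sumr cis_sum (big_nat_widen 0 l n) ?(ltnW (ltn_ord l)) // big_mkord.
apply: eq_bigr => j _.
by rewrite /cgate !qbitE mem_gate_input /merged_angle mulNr.
Qed.

Lemma normsq_phase (k : 'I_p) (x : bits n) : normsq (phase (cgate s0 n) k x) = 1.
Proof.
have := congr1 (@normsq R) (phase_input k x).
by rewrite normsqM !normsq_cis mul1r.
Qed.

Local Notation psiQ := (psi (n := n) (cmix s0) (cgate s0 n)).
Local Notation phiQ := (phi (n := n) (cmix s0) (cgate s0 n)).

Lemma layer_entry (k : 'I_p) (v : 'cV[R[i]]_#|{: bits n}|) z :
  (layer Q k *m v) (enum_rank z) ord0 = \sum_x
    cis (- gamma Q k * constant_cost Q) * phase (cgate s0 n) k x *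
    v (enum_rank x) ord0 * \prod_(0 <= j < n) cmix s0 k (qbit x j) (qbit z j).
Proof.
rewrite /layer; have := mixer_exp (n := n) (beta Q k).
move: (expmx (_ *: mixer R n)) => M ME.
rewrite mxE (reindex (@enum_rank (bits n))) /=; last exact: onW_bij (@enum_rank_bij _).
apply: eq_bigr => x _; rewrite mxE (bigD1 (enum_rank x)) //= big1 ?addr0; last first.
  by move=> u /negbTE ux; rewrite cost_exp ux mul0r mulr0.
rewrite ME cost_exp eqxx mul1r !enum_rankK -phase_input big_mkord.
rewrite -[LHS]mulrA [LHS]mulrC; congr (_ * _).
by apply: eq_bigr => j _; rewrite cmix_input !qbitE [x j == _]eq_sym.
Qed.

(** [psi] omits the normalisation of the initial state and the phases of the constant terms. Both
    are collected in [u], of which only the modulus matters. *)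
Lemma state_entry K : (K <= p)%N -> exists u : R[i], normsq u = 2^-1 ^+ n /\
  forall z, foldl (fun v k => layer Q k *m v) (plus_state R n) (take K (enum 'I_p))
    (enum_rank z) ord0 = u * psiQ K z.
Proof.
elim: K => [_|K IH Kp].
  exists ((Num.sqrt 2)^-1 ^+ n)%:C; split=> [|z]; last by rewrite take0 mxE mulr1.
  rewrite /normsq /= [0 ^+ 2]expr0n addr0 exprAC; congr (_ ^+ n).
  by rewrite exprVn sqr_sqrtr.
have [u [Nu hu]] := IH (ltnW Kp).
exists (cis (- gamma Q (Ordinal Kp) * constant_cost Q) * u); split=> [|z].
  by rewrite normsqM normsq_cis mul1r.
rewrite (take_nth (Ordinal Kp)) ?size_enum_ord // foldl_rcons.
have -> : nth (Ordinal Kp) (enum 'I_p) K = Ordinal Kp.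
  by apply: val_inj; rewrite /= nth_enum_ord.
rewrite layer_entry psiS [RHS]big_distrr; apply: eq_bigr => x _.
rewrite hu; move: (phase _ _ _) (psi _ _ _ _) (\prod_(_ <= _ < _) _) (cis _).
by move=> a b c d /=; ring.
Qed.

Lemma output_distributionE z :
  output_distribution Q z = 2^-1 ^+ n * normsq (psiQ p z).
Proof.
have [u [Nu hu]] := state_entry (leqnn p).
rewrite /output_distribution normcX2 /qaoa_state.
by rewrite -[enum 'I_p]take_size size_enum_ord hu normsqM Nu.
Qed.

(** By [phiS] the gate acts on the two amplitudes at [j] as a 2 by 2 unitary matrix, so it preserves
    the sum of their squared moduli. *)
Lemma phi_unitary K (j : 'I_n) z : (K < p)%N ->
  normsq (phiQ K j.+1 (setb z j true)) + normsq (phiQ K j.+1 (setb z j false)) =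
  normsq (phiQ K j (setb z j true)) + normsq (phiQ K j (setb z j false)).
Proof.
move=> Kp; rewrite !phiS !setbb !ffunE eqxx -[K]/(val (Ordinal Kp)) !cmix_input /=.
by apply: normsq_unitary; rewrite sqrrN cos2Dsin2.
Qed.

Lemma psi_phi0 K z : (K < p)%N -> normsq (phiQ K 0 z) = normsq (psiQ K z).
Proof.
by move=> Kp; rewrite phi0 normsqM (normsq_phase (Ordinal Kp)) mul1r.
Qed.

Lemma adjacency_input (j l : 'I_n) : nmem s0 1 (j * n + l) = interacts Q j l :> nat.
Proof.
rewrite /= -[(j * n + l)%N]/((fun t : 'I_n * 'I_n => t.1 * n + t.2)%N (j, l)).
rewrite table_at // => -[a b] [c d] /= /eqP; rewrite digits_inj //.
by move=> /andP[/eqP/val_inj -> /eqP/val_inj ->].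
Qed.

Lemma interacts_sym (j l : 'I_n) : interacts Q j l = interacts Q l j.
Proof.
by rewrite /interacts eq_sym; congr (_ && _); apply: eq_existsb => i; rewrite andbC.
Qed.

Lemma merged_cost_noninteracting (j l : 'I_n) a b :
  j != l -> ~~ interacts Q j l -> merged_cost Q j l a b = 0.
Proof.
move=> jl; rewrite /interacts jl negb_exists => /forallP h.
apply: big_pred0 => i; apply/negbTE; apply: contra (h i) => /eqP ->.
by rewrite !finset.in_set2 !eqxx orbT.
Qed.

(** A pair that does not interact has no term to merge: its gates have angle 0, and its weight is a
    product of ones. *)
Lemma elim_inv_input K J s : (K < p)%N -> (interaction_degree Q <= 2)%N ->
  (forall a e, (a < 4)%N -> rmem s a e = rmem s0 a e) ->
  (forall e, nmem s 1 e = nmem s0 1 e) ->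
  elim_inv (2 ^ K.+1) n n (fun j l => (0 < nmem s 1 (j * n + l))%N)
    (mem_weight s n K J).
Proof.
move=> Kp deg rE aE.
have adjE (j l : 'I_n) : (0 < nmem s 1 (j * n + l))%N = interacts Q j l.
  by rewrite aE adjacency_input lt0b.
split.
- move=> j l x y /andP[jl ln] nA xS yS; have jn := ltn_trans jl ln.
  rewrite /mem_weight big_nat big1 // => k /andP[_ kK].
  have kp : (k < p)%N by apply: leq_trans kK Kp.
  rewrite /mem_factor [(n <= j)%N]leqNgt jn [(n <= l)%N]leqNgt ln /=.
  rewrite /mem_gate /cmem !rE // -/(cmem s0 2 3 _) -/(mem_gate s0 n k j l _ _).
  rewrite -[k]/(val (Ordinal kp)) -[j]/(val (Ordinal jn)) -[l]/(val (Ordinal ln)).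
  rewrite mem_gate_input /merged_angle merged_cost_noninteracting ?mulr0 ?oppr0 ?cis0 //.
    by rewrite -val_eqE /= ltn_eqF.
  by rewrite -adjE.
- move=> v x y vn xS yS; rewrite /mem_weight big1 // => k _.
  by rewrite /mem_factor leqnn.
move=> v vn; apply: leq_trans deg; rewrite /interaction_degree.
apply: leq_trans (leq_bigmax (Ordinal vn)).
(* The linked numbers below [n] are the neighbours in the interaction graph; its symmetry merges the
   two orders distinguished by [linked]. *)
rewrite -size_filter cardE.
suff -> : [seq j <- iota 0 n | linked (fun j l => (0 < nmem s 1 (j * n + l))%N) v j]
   = map val (enum [set l | interacts Q (Ordinal vn) l]%SET) by rewrite size_map.
rewrite -val_enum_ord filter_map; congr (map _ _).
rewrite enumT [in RHS]/enum_mem; apply: eq_filter => l; rewrite /= finset.in_set /linked.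
have [lv|vl|lv] := ltngtP l v.
- by rewrite orbF interacts_sym -adjE.
- by rewrite /= -adjE.
rewrite /= /interacts -val_eqE /= lv eqxx //.
Qed.

(** The test [j <= J] in [mem_factor] mixes the first [J + 1] qubits, hence [J.+1] on the right. *)
Lemma partition_fun_input K J s (z : bits n) (o : 'I_(2 ^ K.+1)) : (J < n)%N ->
  (forall a e, (a < 4)%N -> rmem s a e = rmem s0 a e) ->
  (forall j : 'I_n, nmem s 2 j = z j) ->
  partition_fun o n n (mem_weight s n K J) = phiQ K J.+1 z.
Proof.
move=> Jn rE zE; apply: partition_fun_phi.
- by rewrite /mem_weight big1 // => k _; rewrite /mem_factor leqnn.
- move=> j x jn xS; apply: eq_bigr => k _.
  rewrite /mem_factor [(n <= j)%N]leqNgt jn leqnn /= /mem_gate /cmem !rE //.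
  congr (_ * _); rewrite -[j]/(val (Ordinal jn)) zE qbitE /cmix /mem_mix !rE //.
  rewrite ltnS; case: (k < K)%N; case: (j <= J)%N => //=.
  by case: (bit x k); case: (z _).
move=> j l x y /andP[jl ln] xS yS; apply: eq_bigr => k _.
rewrite /mem_factor [(n <= j)%N]leqNgt (ltn_trans jl ln) [(n <= l)%N]leqNgt ln /=.
by rewrite /mem_gate /cmem !rE.
Qed.

End Input.
End Circuits.

(** * The sampler *)

Definition pE : nexpr := NGet 0 (NConst 1).

(** Multiples grow by one addition per round. Halves and parities are filled at [2 * i] and
    [2 * i + 1], so nothing is ever divided; the parities of even numbers keep their initial value
    0. *)
Definition TableEntry : cmd :=
  let i := nvar 20 in let i2 := NAdd (nvar 20) (nvar 20) in
  Seq (NSet 3 (NAdd i (NConst 1)) (NAdd (NGet 3 i) (nvar 11)))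
  (Seq (NSet 4 (NAdd i (NConst 1)) (NAdd (NGet 4 i) nE))
  (Seq (NSet 5 i2 i)
  (Seq (NSet 5 (NAdd i2 (NConst 1)) i)
       (NSet 6 (NAdd i2 (NConst 1)) (NConst 1))))).

(* Cells 10 to 13 receive 2 ^ p, the radix B, B ^ 2 and B ^ 3. *)
Definition Prepare : cmd :=
  Seq (NSet 10 (NConst 0) (NConst 1))
  (Seq (For 20 pE (NSet 10 (NConst 0) (NAdd (nvar 10) (nvar 10))))
  (Seq (NSet 11 (NConst 0) (NAdd (NAdd nE (NConst 1)) (nvar 10)))
  (Seq (For 20 (nvar 11) (NSet 12 (NConst 0) (NAdd (nvar 12) (nvar 11))))
  (Seq (For 20 (nvar 11) (NSet 13 (NConst 0) (NAdd (nvar 13) (nvar 12))))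
       (For 20 (nvar 13) TableEntry))))).

Definition normsqE (x : cexpr) : rexpr := RAdd (RMul x.1 x.1) (RMul x.2 x.2).

Definition Weights : cmd :=
  Seq (NSet 2 qubitE (NConst 1))
  (Seq Amplitude
  (Seq (RSet 9 (NConst 1) (normsqE amplitudeE))
  (Seq (NSet 2 qubitE (NConst 0))
  (Seq Amplitude
       (RSet 9 (NConst 0) (normsqE amplitudeE)))))).

(** The factor [2^-1 ^+ n] and the global phase cancel in the ratio, so unnormalised amplitudes
    suffice. *)
Definition Resample : cmd :=
  let w b := RGet 9 (NConst b) in
  Seq Weights (Coin 2 qubitE (RDiv (w 1%N) (RAdd (w 1%N) (w 0%N)))).

Definition Sampler : cmd :=
  Seq Prepare
  (Seq (For 16 nE (Coin 2 qubitE (RDiv ROne (RAdd ROne ROne))))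
  (Seq (NSet 14 (NConst 0) (NConst 1))
       (For 15 pE (Seq (NSet 14 (NConst 0) (NAdd (nvar 14) (nvar 14)))
                       (For 16 nE Resample))))).

(** A digit must hold both a vertex, including the dummy [n], and a path, a number below
    [2 ^ (K + 1)] with [K < p]. *)
Definition radix (n p : nat) : nat := (n + 1 + 2 ^ p)%N.

Definition sampler_time (n p : nat) : nat := (1000 * radix n p ^ 7)%N.

(** * Correctness of the sampler, gate by gate and layer by layer *)

Section SamplerCorrect.
Local Open Scope complex_scope.
Variables (R : realType) (n p : nat) (Q : qaoa R n p).
Hypothesis degQ : (interaction_degree Q <= 2)%N.
Implicit Types s : store R.
Local Notation s0 := (input_store Q).
Local Notation B := (radix n p).
Local Notation psiQ := (psi (n := n) (cmix s0) (cgate s0 n)).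
Local Notation phiQ := (phi (n := n) (cmix s0) (cgate s0 n)).

Lemma framed_nset s a e v : framed [:: a] [::] s (nset s a e v).
Proof. by split=> // a' e'; rewrite inE /= /update => /negbTE ->. Qed.

Lemma framed_rset s a e v : framed [::] [:: a] s (rset s a e v).
Proof. by split=> // a' e'; rewrite inE /= /update => /negbTE ->. Qed.

Record prepared s : Prop := Prepared {
  prep_n : nmem s 0 0 = n;
  prep_p : nmem s 0 1 = p;
  prep_mulB : forall x, (x < B ^ 3)%N -> nmem s 3 x = (x * B)%N;
  prep_muln : forall x, (x < B ^ 3)%N -> nmem s 4 x = (x * n)%N;
  prep_half : forall x, (x < B ^ 3)%N -> nmem s 5 x = x./2;
  prep_odd : forall x, (x < B ^ 3)%N -> nmem s 6 x = odd x;
  prep_adj : forall e, nmem s 1 e = nmem s0 1 e;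
  prep_real : forall a e, (a < 4)%N -> rmem s a e = rmem s0 a e }.

Lemma prepared_framed L L' s s' : framed L L' s s' ->
  all (fun a => a \notin L) [:: 0; 1; 3; 4; 5; 6]%N ->
  all (fun a => a \notin L') [:: 0; 1; 2; 3]%N -> prepared s -> prepared s'.
Proof.
move=> [fn fr] /and5P[h0 h1 h3 h4 /and3P[h5 h6 _]] /and5P[r0 r1 r2 r3 _].
case=> en ep eB em eh eo ea er.
constructor=> [||x xB|x xB|x xB|x xB|e|a e a4]; try by rewrite fn //; auto.
by move: a4; case: a => [|[|[|[|//]]]] a4; rewrite fr // er.
Qed.

Lemma radix_gt : (n < B)%N.
Proof. by rewrite /radix; lia. Qed.

Lemma tc_prepare : tc Prepare s0 (60 * B ^ 3) prepared.
Proof.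
have nB := radix_gt; have B0 : (0 < B)%N by lia.
have B3 : (B <= B ^ 3)%N by rewrite -{1}[B]expn1 leq_pexp2l.
have pB : (p <= B)%N by have := ltn_expl p (isT : (1 < 2)%N); rewrite /radix; lia.
apply: (tc_seq (T1 := 1) (T2 := 50 * B ^ 3)); first by lia.
apply: tc_nset => //; set s1 := nset _ _ _ _.
have fr1 := framed_nset s0 10 0 1 : framed [:: 10]%N [::] s0 s1.
apply: (tc_seq (T1 := 7 * B) (T2 := 42 * B ^ 3)); first by lia.
apply: (tc_conseq (T := 7 * B)); [|exact: leqnn|].
  apply: (tc_for (N := p) (T := 1) (I := fun i s' => nmem s' 10 0 = (2 ^ i)%N)) => //.
  - by move=> s' fr; rewrite /= fr.1.
  - by move=> i s' ip fr hi h; apply: tc_nset => //=; rewrite /update /= h expnS; lia.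
  by lia.
move=> s2 _ [fr2 h10].
apply: (tc_seq (T1 := 1) (T2 := 40 * B ^ 3)); first by lia.
apply: tc_nset => //; set s3 := nset _ _ _ _.
have fr3 : framed [:: 10; 11; 20]%N [::] s0 s3.
  by apply: framed_step (framed_step (framed_step (framed_refl _ _ _) fr1 _) fr2 _)
    (framed_nset _ _ _ _) _.
have h11 : nmem s3 11 0 = B.
  by rewrite /s3 /= /update /= h10 fr2.1 // fr1.1.
apply: (tc_seq (T1 := 7 * B) (T2 := 31 * B ^ 3)); first by lia.
apply: (tc_conseq (T := 7 * B)); [|exact: leqnn|].
  apply: (tc_for (N := B) (T := 1) (I := fun i s' => nmem s' 12 0 = (i * B)%N)) => //.
  - by move=> s' fr; rewrite /= fr.1.
  - by rewrite fr3.1.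
  - move=> i s' ip fr hi h; apply: tc_nset => //=; rewrite /update /= h.
    by rewrite fr.1 // h11 mulSn addnC.
  by lia.
move=> s4 _ [fr4 h12].
apply: (tc_seq (T1 := 7 * B) (T2 := 20 * B ^ 3)); first by lia.
apply: (tc_conseq (T := 7 * B)); [|exact: leqnn|].
  apply: (tc_for (N := B) (T := 1) (I := fun i s' => nmem s' 13 0 = (i * (B * B))%N)) => //.
  - by move=> s' fr; rewrite /= fr.1 // fr4.1.
  - by rewrite fr4.1 // fr3.1.
  - move=> i s' ip fr hi h; apply: tc_nset => //=; rewrite /update /= h.
    by rewrite fr.1 // h12 mulSn addnC.
  by lia.
move=> s5 _ [fr5 h13].
have fr50 : framed [:: 10; 11; 12; 13; 20]%N [::] s0 s5.
  by apply: framed_step (framed_step (framed_step (framed_refl _ _ _) fr3 _) fr4 _)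
    fr5 _.
have hB : nmem s5 11 0 = B by rewrite fr5.1 // fr4.1.
apply: (tc_conseq (T := 20 * B ^ 3)); [|exact: leqnn|].
  apply: (tc_for (N := B ^ 3) (T := 9) (I := fun i s' =>
    [/\ forall x, (x <= i)%N -> nmem s' 3 x = (x * B)%N,
        forall x, (x <= i)%N -> nmem s' 4 x = (x * n)%N,
        forall x, (x < i + i)%N -> nmem s' 5 x = x./2,
        forall x, (x < i + i)%N -> nmem s' 6 x = odd x &
        forall x, (i + i <= x)%N -> nmem s' 6 x = 0%N])) => //.
  - by move=> s' fr; rewrite /= fr.1 // h13 !expnS expn0; lia.
  - split=> [x|x|x|x|x]; rewrite ?leqn0.
    + by move=> /eqP ->; rewrite fr50.1.
    + by move=> /eqP ->; rewrite fr50.1.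
    + by lia.
    + by lia.
    by rewrite fr50.1.
  - move=> i s' iB fr hi [m3 m4 m5 m6 z6].
    have hB' : nmem s' 11 0 = B by rewrite fr.1.
    have hn' : nmem s' 0 0 = n by rewrite fr.1 // fr50.1.
    apply: (tc_seq (T1 := 1) (T2 := 7)) => //; apply: tc_nset => //.
    apply: (tc_seq (T1 := 1) (T2 := 5)) => //; apply: tc_nset => //.
    apply: (tc_seq (T1 := 1) (T2 := 3)) => //; apply: tc_nset => //.
    apply: (tc_seq (T1 := 1) (T2 := 1)) => //; apply: tc_nset => //.
    apply: tc_nset => //=; rewrite /update /= hi hB' hn'.
    split=> x xi.
    + case: eqP => [->|ne]; first by rewrite m3 // mulnDl mul1n.
      by rewrite m3 //; lia.
    + case: eqP => [->|ne]; first by rewrite m4 // mulnDl mul1n.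
      by rewrite m4 //; lia.
    + case: eqP => [->|ne]; first by lia.
      by case: eqP => [->|ne']; [lia|rewrite m5 //; lia].
    + case: eqP => [->|ne]; first by lia.
      case: (ltnP x (i + i)) => h; first by rewrite m6.
      by rewrite z6 //; lia.
    by case: eqP => [e|ne]; [lia|rewrite z6 //; lia].
  by lia.
move=> s6 _ [fr6 [m3 m4 m5 m6 _]].
have fr60 := framed_step (framed_step
  (framed_refl [:: 3; 4; 5; 6; 10; 11; 12; 13; 20]%N [::] s0) fr50 isT) fr6 isT.
constructor=> [||x xB|x xB|x xB|x xB|e|a e a4].
- by rewrite fr60.1.
- by rewrite fr60.1.
- by rewrite m3 // ltnW.
- by rewrite m4 // ltnW.
- by rewrite m5 //; lia.
- by rewrite m6 //; lia.
- by rewrite fr60.1.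
by rewrite fr60.2.
Qed.

Definition counters K J s : Prop :=
  [/\ prepared s, nmem s 14 0 = (2 ^ K.+1)%N, nmem s 15 0 = K & nmem s 16 0 = J].

Lemma counters_framed L L' K J s s' : framed L L' s s' ->
  all (fun a => a \notin L) [:: 0; 1; 3; 4; 5; 6]%N ->
  all (fun a => a \notin L') [:: 0; 1; 2; 3]%N ->
  all (fun a => a \notin L) [:: 14; 15; 16]%N ->
  counters K J s -> counters K J s'.
Proof.
move=> fr h h' /and4P[h14 h15 h16 _] [P e14 e15 e16].
by split; [apply: prepared_framed fr h h' P|rewrite fr.1..].
Qed.

Definition holds (z : bits n) s : Prop := forall j : 'I_n, nmem s 2 j = z j.

Section OneQubit.
Variables (K : nat) (J : 'I_n).
Hypothesis Kp : (K < p)%N.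

Lemma tc_weight z s : counters K J s -> holds z s ->
  tc Amplitude s (300 * B ^ 5)
    (fun s' => reval s' (normsqE amplitudeE) = normsq (phiQ K J.+1 z)).
Proof.
move=> [P e14 e15 e16] hz.
have E : env s n B K J.
  have [en ep eB em eh eo ea er] := P; constructor=> //; first exact: radix_gt.
  by apply: leq_trans (leq_addl _ _); rewrite leq_exp2l.
have o : 'I_(2 ^ K.+1) by exists 0%N; rewrite expn_gt0.
apply: tc_conseq (tc_amplitude o E _) _ _ => //.
  by apply: (elim_inv_input (Q := Q)) => //; case: P.
move=> s' _; rewrite (partition_fun_input (Q := Q) (z := z)) //; last by case: P.
by move=> <-.
Qed.

Lemma tc_weights z s : counters K J s -> holds z s ->
  tc Weights s (610 * B ^ 5) (fun s' =>
    [/\ counters K J s', forall j : 'I_n, j != J -> nmem s' 2 j = z j,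
        rmem s' 9 1 = normsq (phiQ K J.+1 (setb z J true)) &
        rmem s' 9 0 = normsq (phiQ K J.+1 (setb z J false))]).
Proof.
move=> Cs hz; have B5 : (0 < B ^ 5)%N by rewrite expn_gt0 addn_gt0 addn1.
have hold_nset (b : bool) s' : counters K J s' ->
    (forall j : 'I_n, j != J -> nmem s' 2 j = z j) ->
    holds (setb z J b) (nset s' 2 (neval s' qubitE) b).
  move=> [_ _ _ e16] hz' j; rewrite /= /update e16 ffunE /= val_eqE.
  by case: (eqVneq j J) => // /hz'.
apply: (tc_seq (T1 := 1) (T2 := 608 * B ^ 5)); first by lia.
apply: tc_nset => //; set s1 := nset _ _ _ _.
have C1 : counters K J s1 by apply: counters_framed (framed_nset _ _ _ _) _ _ _ Cs.
have hz1 : holds (setb z J true) s1 by apply: hold_nset => // j _; apply: hz.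
apply: (tc_seq (T1 := 300 * B ^ 5) (T2 := 307 * B ^ 5)); first by lia.
apply: tc_conseq (tc_weight C1 hz1) _ _ => // s2 fr2 w1.
have C2 : counters K J s2 by apply: counters_framed fr2 _ _ _ C1.
apply: (tc_seq (T1 := 1) (T2 := 305 * B ^ 5)); first by lia.
apply: tc_rset => //; set s3 := rset _ _ _ _.
have C3 : counters K J s3 by apply: counters_framed (framed_rset _ _ _ _) _ _ _ C2.
apply: (tc_seq (T1 := 1) (T2 := 303 * B ^ 5)); first by lia.
apply: tc_nset => //; set s4 := nset _ _ _ _.
have C4 : counters K J s4 by apply: counters_framed (framed_nset _ _ _ _) _ _ _ C3.
have hz4 : holds (setb z J false) s4.
  apply: hold_nset => // j nj; rewrite /s3 /= fr2.1 // hz1 ffunE.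
  by rewrite (negbTE nj).
apply: (tc_seq (T1 := 300 * B ^ 5) (T2 := 1)); first by lia.
apply: tc_conseq (tc_weight C4 hz4) _ _ => // s5 fr5 w0.
have C5 : counters K J s5 by apply: counters_framed fr5 _ _ _ C4.
apply: tc_rset => //; split.
- by apply: counters_framed (framed_rset _ _ _ _) _ _ _ C5.
- move=> j nj; rewrite [nmem _ _ _]/= fr5.1 // hz4 ffunE.
  by rewrite (negbTE nj).
- by rewrite -[LHS]/(rmem s5 9 1) fr5.2 // -w1.
by rewrite -[LHS]/(reval s5 (normsqE amplitudeE)).
Qed.

Definition gate_dist (j : nat) (z : bits n) : R := 2^-1 ^+ n * normsq (phiQ K j z).

Definition qubit_inv (j : nat) z s : Prop :=
  [/\ prepared s, nmem s 14 0 = (2 ^ K.+1)%N, nmem s 15 0 = K & holds z s].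

Lemma resample_transforms :
  transforms Resample (620 * B ^ 5)
    (fun z s => qubit_inv J z s /\ nmem s 16 0 = J)
    (fun z s => qubit_inv J.+1 z s /\ nmem s 16 0 = J)
    (gate_dist J) (gate_dist J.+1).
Proof.
have B5 : (0 < B ^ 5)%N by rewrite expn_gt0 addn_gt0 addn1.
pose w (b : bool) z := normsq (phiQ K J.+1 (setb z J b)).
pose I2 (z : bits n) s := [/\ counters K J s, forall j : 'I_n, j != J -> nmem s 2 j = z j,
  rmem s 9 1 = w true z & rmem s 9 0 = w false z].
have w_ge0 b z : 0 <= w b z by apply: normsq_ge0.
(* By unitarity the total weight after the gate is the marginal before it, so the ratio of weights
   is the right conditional probability. *)
have wE z : 2^-1 ^+ n * (w true z + w false z) =
    gate_dist J (setb z J true) + gate_dist J (setb z J false).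
  by rewrite /gate_dist -mulrDr -phi_unitary.
have w_setb b b' z : w b (setb z J b') = w b z by rewrite /w setbb.
apply: (transforms_weaken (T := (610 * B ^ 5 + 1).+1)
  (I := fun z s => qubit_inv J z s /\ nmem s 16 0 = J)
  (I' := fun z s => qubit_inv J.+1 z s /\ nmem s 16 0 = J)) => //; last first.
- by lia.
apply: (transforms_seq (I2 := I2) (D2 := gate_dist J)).
  by apply: transforms_tc => z s [[P e14 e15 hz] e16]; apply: tc_weights.
apply: (transforms_coin (j := J) (q := fun z => w true z / (w true z + w false z))).
- move=> z s [Cs hz e1 e0]; have [P e14 e15 e16] := Cs.
  have inv' (b : bool) : qubit_inv J.+1 (setb z J b) (nset s 2 J b) /\
      nmem (nset s 2 J b) 16 0 = J.
    split=> //; split=> //; first by apply: prepared_framed (framed_nset _ _ _ _) _ _ P.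
    move=> j; rewrite /= /update ffunE /= val_eqE.
    by case: (eqVneq j J) => // /hz.
  split; [by []| |exact: (inv' true)|exact: (inv' false)].
  (* The clamping in [Coin] does nothing: the ratio lies between 0 and 1, also when it is
     [0 / 0 = 0]. *)
  rewrite /= e1 e0 min_r ?max_r //; first by rewrite divr_ge0 // addr_ge0.
  have [e|ne] := eqVneq (w true z + w false z) 0; first by rewrite e invr0 mulr0 ler01.
  by rewrite ler_pdivrMr ?mul1r ?lerDl // lt_def ne addr_ge0.
- by move=> z b; rewrite !w_setb.
- move=> z; rewrite -wE /gate_dist -/(w true z).
  (* If both weights vanish, so does the marginal, and the value of [q] is immaterial. *)
  have [e|ne] := eqVneq (w true z + w false z) 0; last by field.
  have : w true z = 0.
    by apply/eqP; move/eqP: e; rewrite paddr_eq0 // => /andP[].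
  by move=> ->; rewrite !(mul0r, mulr0).
move=> z; rewrite -wE /gate_dist -/(w false z).
have [e|ne] := eqVneq (w true z + w false z) 0; last by field.
have : w false z = 0.
  by apply/eqP; move/eqP: e; rewrite paddr_eq0 // => /andP[].
by move=> w0; rewrite e w0 !mulr0.
Qed.

End OneQubit.

Definition layer_dist K (z : bits n) : R := 2^-1 ^+ n * normsq (psiQ K z).

Definition layer_inv K z s : Prop :=
  [/\ prepared s, nmem s 14 0 = (2 ^ K)%N & holds z s].

Lemma layer_transforms K : (K < p)%N ->
  transforms (Seq (NSet 14 (NConst 0) (NAdd (nvar 14) (nvar 14))) (For 16 nE Resample))
    (640 * B ^ 6)
    (fun z s => layer_inv K z s /\ nmem s 15 0 = K)
    (fun z s => layer_inv K.+1 z s /\ nmem s 15 0 = K)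
    (layer_dist K) (layer_dist K.+1).
Proof.
move=> Kp; have nB := radix_gt.
have B5 : (0 < B ^ 5)%N by rewrite expn_gt0 addn_gt0 addn1.
have B6 : (0 < B ^ 6)%N by rewrite expn_gt0 addn_gt0 addn1.
have dist0 : gate_dist K 0 = layer_dist K.
  by apply/funext => z; rewrite /gate_dist psi_phi0.
have distn : gate_dist K n = layer_dist K.+1.
  by apply/funext => z; rewrite /gate_dist phi_full.
apply: (transforms_weaken (T := (1 + (n * (620 * B ^ 5 + 3) + 3)).+1)
  (I := fun z s => layer_inv K z s /\ nmem s 15 0 = K)
  (I' := qubit_inv K n)) => //; last first.
- by move=> z s [P e14 e15 hz].
- by rewrite (expnSr B 5) mulnA; nia.
rewrite -dist0 -distn.
apply: (transforms_seq (I2 := qubit_inv K 0) (D2 := gate_dist K 0)).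
  apply: transforms_tc => z s [[P e14 hz] e15].
  apply: tc_nset => //=; split=> //.
    by apply: prepared_framed (framed_nset _ _ _ _) _ _ P.
  by rewrite /= /update /= e14 expnS; lia.
apply: (transforms_for (N := n) (I := qubit_inv K)).
- move=> i z s v [P e14 e15 hz]; split=> //.
  by apply: prepared_framed (framed_nset _ _ _ _) _ _ P.
- by move=> i z s [P _ _ _]; rewrite /= (prep_n P).
by move=> i lt_in; apply: (resample_transforms (Ordinal lt_in)).
Qed.

(** Law of the string after [j] fair coins, which simulate measuring the plus state: [j] uniform
    bits, then the zeros of the initial output array. *)
Definition coin_dist (j : nat) (z : bits n) : R :=
  if [forall i : 'I_n, (j <= i)%N ==> ~~ z i] then 2^-1 ^+ j else 0.

Lemma coins_transforms :
  transforms (For 16 nE (Coin 2 qubitE (RDiv ROne (RAdd ROne ROne))))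
    (n * (1 + 3) + 3)
    (fun z s => prepared s /\ holds z s) (fun z s => prepared s /\ holds z s)
    (coin_dist 0) (coin_dist n).
Proof.
apply: (transforms_for (N := n) (I := fun _ z s => prepared s /\ holds z s)).
- move=> i z s v [P hz]; split=> //.
  by apply: prepared_framed (framed_nset _ _ _ _) _ _ P.
- by move=> i z s [P _]; rewrite /= (prep_n P).
move=> i lt_in; pose J := Ordinal lt_in.
have dist_true z : coin_dist i (setb z J true) = 0.
  rewrite /coin_dist ifF //; apply/negbTE; rewrite negb_forall; apply/existsP.
  by exists J; rewrite ffunE eqxx leqnn.
have dist_next z b : coin_dist i.+1 (setb z J b) = 2^-1 * coin_dist i (setb z J false).
  rewrite /coin_dist.
  have -> : [forall k : 'I_n, (i <= k)%N ==> ~~ setb z J false k] =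
            [forall k : 'I_n, (i < k)%N ==> ~~ setb z J b k].
    apply: eq_forallb => k; rewrite !ffunE leq_eqVlt.
    have -> : (i == k) = (k == J) by rewrite eq_sym.
    by case: (eqVneq k J) => [->|]; rewrite //= ltnn.
  by case: ifP => _; rewrite ?exprS ?mulr0.
apply: (transforms_coin (j := J) (q := fun=> 2^-1)).
- move=> z s [[P hz] e16].
  have inv' (b : bool) : (prepared (nset s 2 J b) /\ holds (setb z J b) (nset s 2 J b)) /\
      nmem (nset s 2 J b) 16 0 = i.
    split=> //; split; first by apply: prepared_framed (framed_nset _ _ _ _) _ _ P.
    move=> j; rewrite /= /update ffunE /=.
    have -> : (j == i :> nat) = (j == J) by [].
    by case: (eqVneq j J) => // _; apply: hz.
  split; [by []| |exact: (inv' true)|exact: (inv' false)].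
  by rewrite /= mul1r -[1 + 1]/(2 : R) min_r ?max_r //; lra.
- by [].
- by move=> z; rewrite dist_next dist_true add0r.
by move=> z; rewrite dist_next dist_true add0r; congr (_ * _); lra.
Qed.

Lemma sampler_samples :
  samples_within Sampler s0 (output_distribution Q) (sampler_time n p).
Proof.
have nB := radix_gt; have B0 : (0 < B)%N by lia.
have pB : (p <= B)%N by have := ltn_expl p (isT : (1 < 2)%N); rewrite /radix; lia.
have B7 : (B <= B ^ 7)%N by rewrite -{1}[B]expn1 leq_pexp2l.
have B37 : (B ^ 3 <= B ^ 7)%N by rewrite leq_pexp2l.
have B6 : (0 < B ^ 6)%N by rewrite expn_gt0 B0.
have DE : output_distribution Q = layer_dist p.
  by apply/funext => z; rewrite output_distributionE.
have dist_n : coin_dist n = layer_dist 0.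
  apply/funext => z; rewrite /coin_dist /layer_dist ifT.
    by rewrite /normsq /= expr0n /= addr0 expr1n mulr1.
  by apply/forallP => i; rewrite leqNgt ltn_ord.
rewrite DE; apply: (transforms_samples (z0 := [ffun=> false])
  (I := fun z s => z = [ffun=> false] /\ s = s0) (I' := layer_inv p)
  (D := coin_dist 0)) => //; last first.
- move=> z s' [_ _ hz] w; apply/forallP/eqP => [h|-> j].
    by apply/ffunP => j; have := h j; rewrite hz; case: (z j); case: (w j).
  by rewrite hz.
- move=> z; rewrite /coin_dist.
  case: eqP => [->|nz]; first by rewrite ifT ?expr0 //; apply/forallP => i; rewrite ffunE.
  rewrite ifF //; apply/negP => /forallP h; apply: nz; apply/ffunP => i.
  by rewrite ffunE; apply/negbTE; have := h i.
apply: (transforms_weaken (T :=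
  (60 * B ^ 3 + (n * (1 + 3) + 3 + (1 + (p * (640 * B ^ 6 + 3) + 3)).+1).+1).+1)
  (I := fun z s => z = [ffun=> false] /\ s = s0) (I' := layer_inv p)) => //;
  last first.
  have : (p * (640 * B ^ 6 + 3) + 3 <= 650 * B ^ 7)%N.
    by rewrite (expnSr B 6) mulnA; apply: for_time => //; lia.
  by rewrite /sampler_time; lia.
apply: (transforms_seq (I2 := fun z s => prepared s /\ holds z s) (D2 := coin_dist 0)).
  apply: transforms_tc => z s [-> ->].
  apply: tc_conseq tc_prepare _ _ => // s' fr P; split=> // j.
  by rewrite fr.1 // ffunE.
apply: (transforms_seq coins_transforms); rewrite dist_n.
apply: (transforms_seq (I2 := layer_inv 0) (D2 := layer_dist 0)).
  apply: transforms_tc => z s [P hz]; apply: tc_nset => //; split=> //.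
  by apply: prepared_framed (framed_nset _ _ _ _) _ _ P.
apply: (transforms_for (N := p) (I := layer_inv)).
- move=> i z s v [P e14 hz]; split=> //.
  by apply: prepared_framed (framed_nset _ _ _ _) _ _ P.
- by move=> i z s [P _ _]; rewrite /= (prep_p P).
by move=> K Kp; apply: layer_transforms.
Qed.

End SamplerCorrect.

(** * Running time *)

Section Time.
Variable R : realType.

Lemma expR_ge_exp2 (m : nat) : (2 ^ m)%:R <= expR m%:R :> R.
Proof.
rewrite natrX -[m%:R]mulr1 expRM_natl lerXn2r ?nnegrE ?expR_ge0 //.
by apply: le_trans (expR_ge1Dx 1).
Qed.

(** The 3 is 2 + 1, from [n + 1 <= 2 * n] and [2 ^ p <= n * 2 ^ p]. *)
Lemma radix_le n p : (0 < n)%N -> (radix n p <= 3 * (n * 2 ^ p))%N.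
Proof. by move=> n0; have := expn_gt0 2 p; rewrite /radix; nia. Qed.

Lemma ler_natXn (a b r k : nat) (x : R) : r%:R <= b%:R * x ->
  (a * r ^ k)%:R <= (a * b ^ k)%:R * x ^+ k.
Proof.
move=> h; rewrite !natrM !natrX -mulrA -exprMn ler_wpM2l //.
by rewrite lerXn2r // nnegrE // (le_trans _ h).
Qed.

Lemma sampler_time_exp n p : (0 < n)%N -> (0 < p)%N ->
  (sampler_time n p)%:R <=
  (1000 * 3 ^ 7)%:R * (n * p)%:R ^+ 7 * expR (7%:R * p%:R) :> R.
Proof.
move=> n0 p0; rewrite expRM_natl -mulrA -exprMn.
apply: ler_natXn; apply: le_trans (_ : (3 * (n * p * 2 ^ p))%:R <= _).
  rewrite ler_nat; apply: leq_trans (radix_le _ n0) _.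
  by rewrite leq_mul2l leq_mul2r leq_pmulr ?orbT.
rewrite (natrM _ 3) (natrM _ (n * p)) ler_wpM2l // ler_wpM2l //.
exact: expR_ge_exp2.
Qed.

Lemma sampler_time_log (q : nat -> nat) :
  (fun n => (q n)%:R : R^o) =O_\oo (fun n => ln n%:R : R^o) ->
  exists K c : nat, forall n : nat, (0 < n)%N -> (0 < q n)%N ->
    (sampler_time n (q n) <= K * n ^ c)%N.
Proof.
move=> /eqO_exP[k k0 [N _ hN]].
pose M := Num.bound k.
(* Chain: [2 ^ q n] is at most [expR (q n)], and [q n <= k * ln n <= M * ln n]. *)
have le_exp n : (N <= n)%N -> (0 < n)%N -> (2 ^ q n <= n ^ M)%N.
  move=> Nn n0; rewrite -(ler_nat R); apply: le_trans (expR_ge_exp2 _) _.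
  have n1 : (1 : R) <= n%:R by rewrite ler1n.
  rewrite natrX -[n%:R in leRHS]lnK ?posrE ?ltr0n // -expRM_natl ler_expR.
  have := hN n Nn; rewrite /= ger0_norm // (ger0_norm (ln_ge0 n1)).
  move=> /le_trans; apply; rewrite ler_wpM2r ?ln_ge0 //.
  exact/ltW/archi_boundP/ltW.
(* The sum pays for the finitely many [n < N], where the asymptotic bound says nothing. Beyond them
   the radix is at most [3 * n ^ M.+1], to be raised to the power 7. *)
exists (1000 * 3 ^ 7 + \sum_(m < N) sampler_time m (q m))%N, (7 * M.+1)%N.
move=> n n0 q0; rewrite mulnDl; have [lt_nN|le_Nn] := ltnP n N.
  apply: leq_trans (leq_addl _ _); apply: leq_trans (leq_pmulr _ _); last first.
    by rewrite expn_gt0 n0.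
  by rewrite (bigD1 (Ordinal lt_nN)) //= leq_addr.
apply: leq_trans (leq_addr _ _); rewrite /sampler_time -mulnA leq_mul2l.
rewrite [(7 * _)%N]mulnC expnM -expnMn; apply/orP; right.
rewrite leq_exp2r //; apply: leq_trans (radix_le _ n0) _.
by rewrite leq_mul2l expnS leq_mul2l le_exp // ?orbT.
Qed.

End Time.

Theorem corollary18 (R : realType) :
  exists (prog : cmd) (time : nat -> nat -> nat),
    [/\ forall (n p : nat) (Q : qaoa R n p),
          (0 < n)%N -> (0 < p)%N -> (interaction_degree Q <= 2)%N ->
          samples_within prog (input_store Q) (output_distribution Q) (time n p),
        exists K c d : nat, forall n p : nat, (0 < n)%N -> (0 < p)%N ->
          (time n p)%:R <= K%:R * (n * p)%:R ^+ c * expR (d%:R * p%:R) :> R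
      & forall q : nat -> nat,
          (fun n => (q n)%:R : R^o) =O_\oo (fun n => ln n%:R : R^o) ->
          exists K c : nat, forall n : nat, (0 < n)%N -> (0 < q n)%N ->
            (time n (q n) <= K * n ^ c)%N].
Proof.
exists Sampler, sampler_time; split=> [n p Q _ _ degQ||q qO].
- exact: sampler_samples.
- by exists (1000 * 3 ^ 7)%N, 7%N, 7%N => n p; apply: sampler_time_exp.
exact: sampler_time_log qO.
Qed.
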